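(* Let $\mathcal{L}$ be a Banach Lie algebra. (a) $\mathcal{L}$ belongs to $\mathbf{Sem}(P_{\mathfrak{S}^{\max}})$ if and only if there is a bounded isomorphism $\theta$ from $\mathcal{L}$ onto a subdirect product of some family of (finite-dimensional) subsimple Lie algebras. (b) $\mathcal{L}$ belongs to $\mathbf{Sem}(P_{\mathfrak{J}^{\max}})$ if and only if there is a bounded isomorphism from $\mathcal{L}$ onto a subdirect product of some family of Lie algebras each of which is finite-dimensional simple or one-dimensional. (c) $\mathcal{L}$ belongs to $\mathbf{Sem}(P_{\mathfrak{J}})$ if and only if there is a bounded isomorphism from $\mathcal{L}$ onto a subdirect product of some family of finite-dimensional Lie algebras.
   Context: A Banach Lie algebra is a complex Lie algebra $\mathcal{L}$ which is a Banach space in a norm such that, for some $t_{\mathcal{L}}>0$ (a multiplication constant), $\|[a,b]\|\leq t_{\mathcal{L}}\|a\|\|b\|$ for all $a,b\in\mathcal{L}$. Complex finite-dimensional Lie algebras with arbitrary norms are Banach Lie algebras. $\mathcal{L}\in\mathbf{Sem}(P_{\mathfrak{S}^{\max}})$ means: the intersection of all maximal proper closed Lie subalgebras of finite codimension in $\mathcal{L}$ is $\{0\}$ ($\mathcal{L}$ is called Frattini-free). $\mathcal{L}\in\mathbf{Sem}(P_{\mathfrak{J}^{\max}})$ means: the intersection of all maximal proper closed Lie ideals of finite codimension is $\{0\}$. $\mathcal{L}\in\mathbf{Sem}(P_{\mathfrak{J}})$ means: the intersection of all proper closed Lie ideals of finite codimension is $\{0\}$. (The intersection of an empty family is taken to be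 $\mathcal{L}$.) A finite-dimensional Lie algebra $\mathcal{M}$ is subsimple if either $\dim\mathcal{M}=1$ or it has a proper maximal Lie subalgebra that contains no non-zero Lie ideals of $\mathcal{M}$. Let $\{\mathcal{L}_{\lambda}\}_{\lambda\in\Lambda}$ be a family of Banach Lie algebras with multiplication constants $t_{\lambda}$, $\sup_\lambda t_{\lambda}<\infty$. Their normed direct product is the Banach Lie algebra $\oplus_{\Lambda}\mathcal{L}_{\lambda}=\{(a_{\lambda})_{\lambda\in\Lambda}: a_{\lambda}\in\mathcal{L}_{\lambda},\ \sup_{\lambda}\|a_{\lambda}\|<\infty\}$ with coordinatewise operations and sup norm. For $\mu\in\Lambda$, $\psi_{\mu}((a_{\lambda}))=a_{\mu}$. A Lie subalgebra $\mathcal{M}$ (not necessarily closed) of $\oplus_{\Lambda}\mathcal{L}_{\lambda}$ is a subdirect product of the family $\{\mathcal{L}_{\lambda}\}$ if $\psi_{\mu}(\mathcal{M})=\mathcal{L}_{\mu}$ for each $\mu\in\Lambda$. ''Bounded isomorphism onto'' means a bounded bijective Lie homomorphism; its inverse is not required to be bounded. *)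

(* Defs.v *)
From HB Require Import structures.
From mathcomp Require Import all_boot all_order all_algebra.
From mathcomp Require Import complex.
From mathcomp Require Import all_classical all_reals all_analysis.

Set Implicit Arguments.
Unset Strict Implicit.
Unset Printing Implicit Defensive.

Import Order.TTheory GRing.Theory Num.Theory.
Import numFieldNormedType.Exports.

Local Open Scope classical_set_scope.
Local Open Scope complex_scope.
Local Open Scope ring_scope.

HB.mixin Record Lmodule_isLie (K : numFieldType) L of GRing.Lmodule K L := {
  lie : L -> L -> L;
  lie_linearl : forall b, linear (lie^~ b);
  lie_linearr : forall a, linear (lie a);
  liexx : forall a, lie a a = 0;
  lie_jacobi : forall a b c,
    lie a (lie b c) + lie b (lie c a) + lie c (lie a b) = 0
}.

#[short(type="lieAlgType")]
HB.structure Definition LieAlgebra (K : numFieldType) :=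
  {L of GRing.Lmodule K L & Lmodule_isLie K L}.

HB.mixin Record NormedLie_isBanachLie (K : numFieldType) L
    of LieAlgebra K L & CompleteNormedModule K L := {
  lie_bounded : exists2 t : K, 0 < t &
    forall a b : L, `|lie a b| <= t * `|a| * `|b|
}.

#[short(type="banachLieType")]
HB.structure Definition BanachLie (K : numFieldType) :=
  {L of LieAlgebra K L & CompleteNormedModule K L & NormedLie_isBanachLie K L}.

Section LieAlgebraNotions.
Context (K : numFieldType) (L : lieAlgType K).
Implicit Types M N J : set L.

Definition is_subspace M :=
  M 0 /\ forall (k : K) (a b : L), M a -> M b -> M (k *: a + b).

Definition is_lie_subalgebra M :=
  is_subspace M /\ forall a b, M a -> M b -> M (lie a b).

Definition is_lie_ideal J :=
  is_subspace J /\ forall a b, J b -> J (lie a b).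

Definition is_proper M := M <> setT.

(* The linear space L is the sum of M and of the span of finitely many vectors. *)
Definition finite_codim M :=
  exists n (e : 'I_n -> L), forall x : L, exists c : 'I_n -> K,
    M (x - \sum_(i < n) c i *: e i).

(* Prop form of the library's Vector.axiom n L *)
Definition has_dim (n : nat) := exists2 f : L -> 'rV[K]_n, linear f & bijective f.

Definition finite_dim := exists n, has_dim n.

Definition maximal_in (F : set (set L)) M :=
  F M /\ forall N, F N -> M `<=` N -> N = M.

(* Purely algebraic: in finite dimension every subspace is closed. *)
Definition subsimple := finite_dim /\
  (has_dim 1 \/
   exists2 M, maximal_in [set N | is_lie_subalgebra N /\ is_proper N] M &
     forall J, is_lie_ideal J -> J `<=` M -> J = [set 0]).

Definition lie_simple :=
  (exists a b : L, lie a b <> 0) /\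
  forall J, is_lie_ideal J -> J = [set 0] \/ J = setT.

End LieAlgebraNotions.

Arguments has_dim {K} L n.
Arguments finite_dim {K} L.
Arguments subsimple {K} L.
Arguments lie_simple {K} L.

Section BanachLieNotions.
Context (K : numFieldType) (L : banachLieType K).

Definition mult_constant (t : K) :=
  0 < t /\ forall a b : L, `|lie a b| <= t * `|a| * `|b|.

Definition proper_closed_subalgebras : set (set L) :=
  [set M | [/\ is_lie_subalgebra M, closed M & is_proper M]].

Definition proper_closed_ideals : set (set L) :=
  [set J | [/\ is_lie_ideal J, closed J & is_proper J]].

Definition Smax : set (set L) :=
  [set M | maximal_in proper_closed_subalgebras M /\ finite_codim M].

Definition Jmax : set (set L) :=
  [set J | maximal_in proper_closed_ideals J /\ finite_codim J].

Definition Jfin : set (set L) :=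
  [set J | proper_closed_ideals J /\ finite_codim J].

(* The intersection of an empty family of subsets of L is L. *)
Definition Sem (G : set (set L)) := \bigcap_(M in G) M = [set 0].

End BanachLieNotions.

Arguments mult_constant {K} L t.
Arguments Smax {K} L.
Arguments Jmax {K} L.
Arguments Jfin {K} L.

Record banach_lie_family (R : realType) := BanachLieFamily {
  fam_index : Type;
  fam_space :> fam_index -> banachLieType R[i];
  fam_const : fam_index -> R[i];
  fam_constP : forall l, mult_constant (fam_space l) (fam_const l);
  fam_const_bounded : exists T : R[i], forall l, fam_const l <= T
}.

Section NormedDirectProduct.
Context (R : realType) (E : banach_lie_family R).
Local Notation C := R[i].

Record ndprod := NDProd {
  ndcoord :> forall l : fam_index E, E l;
  ndcoord_bounded : exists r : C, forall l, `|ndcoord l| <= r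
}.

Lemma ndprodP (a b : ndprod) : (forall l, a l = b l) -> a = b.
Proof.
case: a b => [a ha] [b hb] /= ab.
have {}ab : a = b by apply: functional_extensionality_dep.
by subst b; congr NDProd; exact: Prop_irrelevance.
Qed.

HB.instance Definition _ := gen_eqMixin ndprod.
HB.instance Definition _ := gen_choiceMixin ndprod.

Lemma nd0_bounded : exists r : C, forall l, `|0 : E l| <= r.
Proof. by exists 0 => l; rewrite normr0. Qed.
Definition nd0 := NDProd nd0_bounded.

Lemma ndN_bounded (a : ndprod) : exists r : C, forall l, `|- a l| <= r.
Proof. by have [r ar] := ndcoord_bounded a; exists r => l; rewrite normrN. Qed.
Definition ndN a := NDProd (ndN_bounded a).

Lemma ndD_bounded (a b : ndprod) : exists r : C, forall l, `|a l + b l| <= r.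
Proof.
have [r ar] := ndcoord_bounded a; have [s bs] := ndcoord_bounded b.
by exists (r + s) => l; rewrite (le_trans (ler_normD _ _))// lerD.
Qed.
Definition ndD a b := NDProd (ndD_bounded a b).

Lemma ndZ_bounded (k : C) (a : ndprod) : exists r : C, forall l, `|k *: a l| <= r.
Proof.
have [r ar] := ndcoord_bounded a.
exists (`|k| * r) => l.
by rewrite normrZ; apply: ler_wpM2l; [exact: normr_ge0|exact: ar].
Qed.
Definition ndZ k a := NDProd (ndZ_bounded k a).

Lemma ndlie_bounded (a b : ndprod) :
  exists r : C, forall l, `|lie (a l) (b l)| <= r.
Proof.
have [r ar] := ndcoord_bounded a; have [s bs] := ndcoord_bounded b.
have [T hT] := fam_const_bounded E.
exists (T * r * s) => l; have [t0 /(_ (a l) (b l)) ht] := fam_constP l.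
rewrite (le_trans ht)// ler_pM// ?mulr_ge0 ?(ltW t0)//.
by rewrite ler_pM// (ltW t0).
Qed.
Definition ndlie a b := NDProd (ndlie_bounded a b).

Lemma ndDA : associative ndD.
Proof. by move=> a b c; apply: ndprodP => l /=; rewrite addrA. Qed.
Lemma ndDC : commutative ndD.
Proof. by move=> a b; apply: ndprodP => l /=; rewrite addrC. Qed.
Lemma nd0D : left_id nd0 ndD.
Proof. by move=> a; apply: ndprodP => l /=; rewrite add0r. Qed.
Lemma ndND : left_inverse nd0 ndN ndD.
Proof. by move=> a; apply: ndprodP => l /=; rewrite addNr. Qed.

HB.instance Definition _ := GRing.isZmodule.Build ndprod ndDA ndDC nd0D ndND.

Lemma ndZA (k m : C) (a : ndprod) : ndZ k (ndZ m a) = ndZ (k * m) a.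
Proof. by apply: ndprodP => l /=; rewrite scalerA. Qed.
Lemma nd1Z : left_id 1 ndZ.
Proof. by move=> a; apply: ndprodP => l /=; rewrite scale1r. Qed.
Lemma ndZDr : right_distributive ndZ +%R.
Proof. by move=> k a b; apply: ndprodP => l /=; rewrite scalerDr. Qed.
Lemma ndZDl (a : ndprod) : {morph ndZ^~ a : k m / k + m}.
Proof. by move=> k m; apply: ndprodP => l /=; rewrite scalerDl. Qed.

HB.instance Definition _ :=
  GRing.Zmodule_isLmodule.Build C ndprod ndZA nd1Z ndZDr ndZDl.

(* Norms of complex normed spaces are R[i]-valued, hence the detour via Re. *)
Definition ndnorm (a : ndprod) : C :=
  (sup [set complex.Re `|a l| | l in [set: fam_index E]])%:C.

Lemma ReK (x : C) : 0 <= x -> (complex.Re x)%:C = x.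
Proof. by case: x => x y; rewrite lecE /= => /andP[/eqP-> _]. Qed.

Lemma nd_has_ubound (a : ndprod) :
  has_ubound [set complex.Re `|a l| | l in [set: fam_index E]].
Proof.
have [r ar] := ndcoord_bounded a; exists (complex.Re r) => _ [l _ <-].
by have := ar l; rewrite lecE => /andP[].
Qed.

Lemma ndnorm_ub (a : ndprod) l : `|a l| <= ndnorm a.
Proof.
rewrite -[leLHS]ReK// lecR.
by apply: (ub_le_sup (nd_has_ubound a)); exists l.
Qed.

Lemma ndnorm_ge0 (a : ndprod) : 0 <= ndnorm a.
Proof.
rewrite -[0]/(0%:C) lecR.
have [[l]|E0] := pselect (exists l : fam_index E, True).
  move=> _; rewrite -lecR; exact: le_trans (ndnorm_ub a l).
rewrite (_ : [set _ | _ in _] = set0) ?sup0//.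
by rewrite -subset0 => x [l _ _]; apply: E0; exists l.
Qed.

Lemma ndnorm_le (a : ndprod) (r : C) :
  0 <= r -> (forall l, `|a l| <= r) -> ndnorm a <= r.
Proof.
move=> r0 ar; rewrite -[r]ReK// lecR.
have [[l _]|E0] := pselect (exists l : fam_index E, True).
  apply: ge_sup; first by exists (complex.Re `|a l|); exists l.
  by move=> _ [m _ <-]; have := ar m; rewrite lecE => /andP[].
rewrite (_ : [set _ | _ in _] = set0) ?sup0.
  by move: r0; rewrite lecE => /andP[].
by rewrite -subset0 => x [l _ _]; apply: E0; exists l.
Qed.

Lemma ndnormD (a b : ndprod) : ndnorm (a + b) <= ndnorm a + ndnorm b.
Proof.
apply: ndnorm_le; first by rewrite addr_ge0// ndnorm_ge0.
by move=> l; rewrite (le_trans (ler_normD _ _))// lerD// ndnorm_ub.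
Qed.

Lemma ndnormZ_le (k : C) (a : ndprod) : ndnorm (k *: a) <= `|k| * ndnorm a.
Proof.
apply: ndnorm_le; first by rewrite mulr_ge0// ndnorm_ge0.
by move=> l; rewrite normrZ ler_wpM2l// ndnorm_ub.
Qed.

Lemma ndnormZ (k : C) (a : ndprod) : ndnorm (k *: a) = `|k| * ndnorm a.
Proof.
apply/eqP; rewrite eq_le ndnormZ_le /=.
have [->|k0] := eqVneq k 0; first by rewrite normr0 mul0r ndnorm_ge0.
have k0' : 0 < `|k| by rewrite normr_gt0.
rewrite -ler_pdivlMl// -normfV.
by rewrite -[in leLHS](scalerK k0 a) ndnormZ_le.
Qed.

Lemma ndnorm_eq0 (a : ndprod) : ndnorm a = 0 -> a = 0.
Proof.
move=> a0; apply: ndprodP => l; apply/eqP.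
by rewrite -normr_le0 -a0 ndnorm_ub.
Qed.

HB.instance Definition _ :=
  Lmodule_isNormed.Build C ndprod ndnormD ndnormZ ndnorm_eq0.

Lemma ndprod_complete (F : set_system ndprod) :
  ProperFilter F -> cauchy F -> cvg F.
Proof.
move=> FF /cauchyP Fc.
have Fl l : cvg ((fun a : ndprod => a l) @ F).
  apply: cauchy_cvg; apply/cauchy_exP => e e0.
  have [a Fa] := Fc e e0; exists (a l) => /=.
  rewrite /nbhs /=; apply: filterS Fa => b /=.
  by rewrite -!ball_normE /=; apply: le_lt_trans; exact: (ndnorm_ub (a - b)).
pose lm l := lim ((fun a : ndprod => a l) @ F).
have lmP (a : ndprod) (e : C) : 0 < e -> F (ball a e) ->
    forall l, `|a l - lm l| <= e.
  move=> e0 Fa l; apply/ler_addgt0Pl => d d0.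
  have /cvgrPdist_lt /(_ d d0) Fd := Fl l.
  have [b [ab bl]] := filter_ex (filterI Fa Fd).
  rewrite -(subrK (b l) (a l)) -addrA (le_trans (ler_normD _ _))//.
  rewrite [leLHS]addrC lerD//; first by rewrite distrC ltW.
  move: ab; rewrite -ball_normE /= => /ltW; apply: le_trans.
  exact: (ndnorm_ub (a - b)).
have lm_bounded : exists r : C, forall l, `|lm l| <= r.
  have [a Fa] := Fc 1 ltr01; have [r ar] := ndcoord_bounded a.
  exists (1 + r) => l; rewrite -[lm l](subrK (a l)).
  rewrite (le_trans (ler_normD _ _))//; apply: lerD; last exact: ar.
  by rewrite distrC; exact: lmP.
apply/cvg_ex; exists (NDProd lm_bounded).
apply/cvgrPdist_le => e e0.
have e20 : 0 < e / 2 by rewrite divr_gt0.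
have [a Fa] := Fc _ e20.
apply: (filterS _ Fa) => b ab.
apply: ndnorm_le; first exact: ltW.
move=> l /=; rewrite -(subrK (a l) (lm l)) -addrA (le_trans (ler_normD _ _))//.
rewrite [e]splitr; apply: lerD.
  by rewrite distrC; exact: (lmP _ _ e20 Fa).
move: ab; rewrite -ball_normE /= => /ltW; apply: le_trans.
exact: (ndnorm_ub (a - b)).
Qed.

HB.instance Definition _ := Uniform_isComplete.Build ndprod ndprod_complete.

Lemma ndlie_linearl b : linear (ndlie^~ b).
Proof. by move=> k a c; apply: ndprodP => l /=; rewrite lie_linearl. Qed.
Lemma ndlie_linearr a : linear (ndlie a).
Proof. by move=> k b c; apply: ndprodP => l /=; rewrite lie_linearr. Qed.
Lemma ndliexx a : ndlie a a = 0.
Proof. by apply: ndprodP => l /=; rewrite liexx. Qed.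
Lemma ndlie_jacobi a b c :
  ndlie a (ndlie b c) + ndlie b (ndlie c a) + ndlie c (ndlie a b) = 0.
Proof. by apply: ndprodP => l /=; rewrite lie_jacobi. Qed.

HB.instance Definition _ := Lmodule_isLie.Build C ndprod
  ndlie_linearl ndlie_linearr ndliexx ndlie_jacobi.

Lemma ndlie_norm : exists2 t : C, 0 < t &
  forall a b : ndprod, `|lie a b| <= t * `|a| * `|b|.
Proof.
have [T hT] := fam_const_bounded E.
have [[l0 _]|E0] := pselect (exists l : fam_index E, True).
  have T0 : 0 < T by apply: lt_le_trans (hT l0); case: (fam_constP l0).
  exists T => // a b; apply: ndnorm_le; first by rewrite !mulr_ge0// ltW.
  move=> l; have [t0 /(_ (a l) (b l)) ht] := fam_constP l.
  rewrite (le_trans ht)// ler_pM// ?mulr_ge0 ?(ltW t0)//; last exact: ndnorm_ub.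
  by rewrite ler_pM// ?(ltW t0)//; exact: ndnorm_ub.
exists 1 => // a b; apply: ndnorm_le; first by rewrite !mulr_ge0.
by move=> l; case: E0; exists l.
Qed.

HB.instance Definition _ := NormedLie_isBanachLie.Build C ndprod ndlie_norm.

Definition subdirect_product (M : set ndprod) :=
  is_lie_subalgebra M /\
  forall m : fam_index E, (fun a : ndprod => a m) @` M = setT.

End NormedDirectProduct.

Definition bounded_isomorphism_onto (K : numFieldType) (L N : banachLieType K)
    (theta : L -> N) (M : set N) :=
  [/\ linear theta,
      forall a b, theta (lie a b) = lie (theta a) (theta b),
      exists r : K, forall a, `|theta a| <= r * `|a| &
      set_bij setT M theta].

Definition is_subdirect_product_of (R : realType) (L : banachLieType R[i])
    (P : lieAlgType R[i] -> Prop) :=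
  exists E : banach_lie_family R, (forall l, P (E l)) /\
  exists (M : set (ndprod E)) (theta : L -> ndprod E),
    subdirect_product M /\ bounded_isomorphism_onto theta M.

(* Main.v *)
(** The easy implications are formal: a closed ideal J of finite codimension
    gives a finite-dimensional quotient of L, and x |-> (x + J)_J is a bounded
    embedding into the product of these quotients.  The two substantial points
    both concern a maximal closed subalgebra M of finite codimension.

    (1) M contains a closed ideal of L of finite codimension.  Let M_0 = M and
    M_(k+1) = {z in M_k | [L,z] <= M_k}; every M_k is closed of finite
    codimension, and M_k is an ideal as soon as M_k = M_(k+1).  If every ad h,
    h in M, is nilpotent on L/M then M is an ideal, by Engel's theorem.
    Otherwise fix h in M with a nonzero eigenvalue on L/M.  The eigenvalues of
    ad h on all the L/M_k are bounded by |ad h|, so a vector x of nonzero weight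
    satisfies (ad x)^N L <= M_k with N independent of k.  The vectors of nonzero
    weight and the brackets [x,y] of vectors of opposite weights span, together
    with M, a subalgebra larger than M, hence L; and [x,y] is a combination of
    the values exp(t ad x) y, which are ad-nilpotent like y.  So L is spanned
    modulo M by n = dim L/M elements x_i with (ad x_i)^N L <= M_k.  Words of
    length k+1 in the ad x_i are symmetric on M_k modulo M, and for k >= nN one
    letter is repeated N times, whence M_k = M_(k+1).

    (2) If M contains no nonzero ideal and L is finite-dimensional, then the
    intersection I of all maximal subalgebras is 0 (even though M itself need
    not be).  The automorphisms exp(t ad x), x ad-nilpotent, preserve I, so
    [x,I] <= I for such x; as these x span L modulo M, the subspace I is
    contained in every M_k, hence is 0. *)

From HB Require Import structures.
Require Import Defs.
From mathcomp Require Import all_boot all_order all_algebra.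
From mathcomp Require Import complex.
From mathcomp Require Import all_classical all_reals all_analysis.
From mathcomp Require Import ring.

Set Implicit Arguments.
Unset Strict Implicit.
Unset Printing Implicit Defensive.

Import Order.TTheory GRing.Theory Num.Theory.
Import numFieldNormedType.Exports.

Local Open Scope classical_set_scope.
Local Open Scope ring_scope.

(** * Bilinearity of the bracket and the Jacobi identity as a Leibniz rule *)

Section LieLinear.
Context (K : numFieldType) (L : lieAlgType K).

HB.instance Definition _ (a : L) :=
  GRing.isLinear.Build K L L _ (lie a) (lie_linearr a).

Lemma lieDl (a b c : L) : lie (a + b) c = lie a c + lie b c.
Proof. by have := lie_linearl c 1 a b; rewrite !scale1r. Qed.

Lemma lie0l (c : L) : lie 0 c = 0.
Proof. by apply: (addrI (lie 0 c)); rewrite -lieDl !addr0. Qed.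

Lemma lieZl (k : K) (a c : L) : lie (k *: a) c = k *: lie a c.
Proof. by have := lie_linearl c k a 0; rewrite !addr0 lie0l addr0. Qed.

Lemma lieZr (k : K) (a c : L) : lie a (k *: c) = k *: lie a c.
Proof. exact: linearZ. Qed.

Lemma lieNl (a c : L) : lie (- a) c = - lie a c.
Proof. by rewrite -scaleN1r lieZl scaleN1r. Qed.

Lemma lieBl (a b c : L) : lie (a - b) c = lie a c - lie b c.
Proof. by rewrite lieDl lieNl. Qed.

Lemma lie_suml I (r : seq I) (P : pred I) (F : I -> L) c :
  lie (\sum_(i <- r | P i) F i) c = \sum_(i <- r | P i) lie (F i) c.
Proof.
by elim/big_rec2: _ => [|i x y _ <-]; rewrite ?lie0l// lieDl.
Qed.

Lemma lieC (a b : L) : lie a b = - lie b a.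
Proof.
have := liexx (a + b); rewrite lieDl !linearD /= !liexx add0r addr0.
by move/eqP; rewrite addr_eq0 => /eqP.
Qed.

Lemma lieA (a b c : L) : lie a (lie b c) = lie (lie a b) c + lie b (lie a c).
Proof.
have := lie_jacobi a b c.
rewrite [lie c (lie a b)]lieC [lie c a]lieC linearN /=.
by move/eqP; rewrite subr_eq0 subr_eq => /eqP.
Qed.

End LieLinear.

Lemma mem_eq T (S : set T) a b : S a -> a = b -> S b.
Proof. by move=> Sa <-. Qed.

(** * Subspaces and linear spans *)

Section Subspaces.
Context (K : numFieldType) (L : lieAlgType K).
Implicit Types (S B : set L) (x y z : L).

Lemma subsp0 S : is_subspace S -> S 0.
Proof. by case. Qed.

Lemma subspD S x y : is_subspace S -> S x -> S y -> S (x + y).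
Proof. by move=> [_ Sl] Sx Sy; have := Sl 1 x y Sx Sy; rewrite scale1r. Qed.

Lemma subspZ S k x : is_subspace S -> S x -> S (k *: x).
Proof. by move=> [S0 Sl] Sx; have := Sl k x 0 Sx S0; rewrite addr0. Qed.

Lemma subspN S x : is_subspace S -> S x -> S (- x).
Proof. by move=> Ss Sx; rewrite -scaleN1r; exact: subspZ. Qed.

Lemma subspB S x y : is_subspace S -> S x -> S y -> S (x - y).
Proof. by move=> Ss Sx Sy; apply: subspD => //; exact: subspN. Qed.

Lemma subsp_subr S x y : is_subspace S -> S (x - y) -> S y -> S x.
Proof. by move=> Ss Sxy Sy; rewrite -(subrK y x); exact: subspD. Qed.

Lemma subsp_sum I (r : seq I) (P : pred I) (F : I -> L) S :
  is_subspace S -> (forall i, P i -> S (F i)) -> S (\sum_(i <- r | P i) F i).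
Proof.
move=> Ss SF; elim/big_ind: _ => //; first exact: subsp0.
by move=> x y; exact: subspD.
Qed.

Lemma subsp_ker (V : lmodType K) (f : {linear L -> V}) :
  is_subspace [set z | f z = 0].
Proof.
split=> [|k a b /= fa fb]; first by rewrite /= linear0.
by rewrite linearP fa fb scaler0 addr0.
Qed.

Lemma subsp_preim S (f : {linear L -> L}) :
  is_subspace S -> is_subspace [set z | S (f z)].
Proof.
move=> Ss; split=> [|k a b /= fa fb]; first by rewrite /= linear0; exact: subsp0.
by rewrite linearP; apply: subspD => //; exact: subspZ.
Qed.

(** Encoded as the intersection of the subspaces containing [S]: a linear property of the elements
    of a span is proved by applying membership to the subspace of all elements with that
    property. *)
Definition lspan S : set L :=
  [set z | forall B, is_subspace B -> S `<=` B -> B z].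

Lemma lspan_subsp S : is_subspace (lspan S).
Proof.
split=> [B Bs _|k a b Ha Hb B Bs SB]; first exact: subsp0.
by apply: subspD => //; [apply: subspZ => //; exact: Ha|exact: Hb].
Qed.

Lemma sub_lspan S : S `<=` lspan S.
Proof. by move=> x Sx B _; exact. Qed.

Lemma lspan_sub S B : is_subspace B -> S `<=` B -> lspan S `<=` B.
Proof. by move=> Bs SB z; exact. Qed.

Lemma lspanS S B : S `<=` B -> lspan S `<=` lspan B.
Proof.
move=> SB; apply: lspan_sub; first exact: lspan_subsp.
exact: subset_trans SB (@sub_lspan _).
Qed.

End Subspaces.

(** * Subspaces of finite codimension as kernels of maps to row vectors *)

Section FiniteCodim.
Context (K : numFieldType) (L : lieAlgType K).
Implicit Types (S B : set L) (x y z : L).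

Definition adapted n S (f : L -> 'rV[K]_n) :=
  forall z, S z <-> f z = 0.

Lemma span_coords n (f : {linear L -> 'rV[K]_n}) (s : seq L) z :
  f z \in <<map f s>>%VS ->
  exists c : nat -> K, f (z - \sum_(i < size s) c i *: s`_i) = 0.
Proof.
move=> zs; pose t := in_tuple (map f s).
(* The coordinates are extended by 0 beyond the length of [s]; the sum never reads these values. *)
exists (fun i => if insub i is Some j then coord t j (f z) else 0).
rewrite linearB linear_sum /= {1}(coord_span (X := t) zs).
apply/eqP; rewrite subr_eq0; apply/eqP.
have st : size (map f s) = size s by rewrite size_map.
rewrite (reindex (cast_ord (esym st))) /=; last first.
  by exists (cast_ord st) => i _; apply: val_inj.
apply: eq_bigr => i _; rewrite linearZ /= (nth_map 0)//.
by congr (_ *: _); rewrite insubT ?st//= => H; congr coord; exact: val_inj.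
Qed.

(** [s] is a longest sequence in [S] with free image; an element of [S] whose image left the span
    could be added to it. *)
Lemma select_basis n (f : {linear L -> 'rV[K]_n}) S :
  exists s : seq L, [/\ (size s <= n)%N, {in s, forall x, S x},
    free (map f s) & forall z, S z ->
    exists c : nat -> K, f (z - \sum_(i < size s) c i *: s`_i) = 0].
Proof.
pose P m := `[< exists s : seq L,
  [/\ size s = m, {in s, forall x, S x} & free (map f s)] >].
have P0 : exists m, P m by exists 0%N; apply/asboolP; exists [::]; split=> //=; rewrite nil_free.
have Pn m : P m -> (m <= n)%N.
  move=> /asboolP[s [<- _]]; rewrite /free size_map => /eqP <-.
  have := dimvS (subvf <<map f s>>).
  by rewrite dimvf /dim /= mul1n.
have [m /asboolP[s [sm sS fs]] mmax] := ex_maxnP P0 Pn.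
exists s; split=> //; first by rewrite sm; apply: Pn; apply/asboolP; exists s.
move=> z Sz; have zs : f z \in <<map f s>>%VS.
  apply: contraT => nz; suff /mmax : P m.+1 by rewrite ltnn.
  apply/asboolP; exists (z :: s); split; rewrite /= ?sm//.
    by move=> x; rewrite inE => /predU1P[->//|/sS].
  by rewrite free_cons nz.
exact: span_coords.
Qed.

Lemma ker_finite_codim n (f : {linear L -> 'rV[K]_n}) :
  finite_codim [set z | f z = 0].
Proof.
have [s [_ _ _ sP]] := select_basis f setT.
exists (size s), (fun i => s`_i) => x.
by have [c cP] := sP x I; exists (fun i => c i).
Qed.

(** For the least possible number [n] of vectors, these are independent modulo [S]; the coordinates
    modulo [S] are then unique, hence linear, and every row vector occurs. *)
Lemma finite_codim_surj S : is_subspace S -> finite_codim S ->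
  exists n (f : {linear L -> 'rV[K]_n}), adapted S f /\
    forall v, exists x, f x = v.
Proof.
move=> Ss; pose P n := `[< exists e : 'I_n -> L, forall x : L,
  exists c : 'I_n -> K, S (x - \sum_(i < n) c i *: e i) >].
move=> fS; have exP : exists n, P n.
  by case: fS => n [e eP]; exists n; apply/asboolP; exists e.
have [n /asboolP[e eP] nmin] := ex_minnP exP.
(* A relation with [c j] nonzero would express [e j] through the other vectors modulo [S], against
   the minimality of [n]. *)
have indep (c : 'I_n -> K) : S (\sum_(i < n) c i *: e i) -> forall i, c i = 0.
  move=> Sc j; apply/eqP; apply: contraT => cj.
  case: n => [|n] in e eP c Sc j cj nmin *; first by case: j cj.
  have /nmin : P n; last by rewrite ltnn.
  apply/asboolP; exists (fun i => e (lift j i)) => x.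
  have [d dP] := eP x.
  exists (fun i => d (lift j i) - d j * (c j)^-1 * c (lift j i)).
  apply: (mem_eq (subspD Ss dP (subspZ (d j * (c j)^-1) Ss Sc))).
  rewrite -addrA; congr (_ + _).
  rewrite [\sum_(i < n.+1) d i *: e i](bigD1_ord j)//=.
  rewrite [\sum_(i < n.+1) c i *: e i](bigD1_ord j)//= scalerDr !scalerA.
  rewrite mulfVK// opprD addrACA addNr add0r scaler_sumr -!sumrN -big_split /=.
  by apply: eq_bigr => i _; rewrite scalerBl scalerA opprB addrC.
have /choice[g gP] x : exists v : 'rV[K]_n, S (x - \sum_(i < n) v 0 i *: e i).
  have [c cP] := eP x; exists (\row_i c i).
  by under eq_bigr do rewrite mxE.
have guniq x (v : 'rV[K]_n) : S (x - \sum_(i < n) v 0 i *: e i) -> g x = v.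
  move=> Sv; apply/rowP => i; apply/eqP; rewrite -subr_eq0; apply/eqP.
  apply: (indep (fun i => g x 0 i - v 0 i)) => {i}.
  apply: (mem_eq (subspB Ss Sv (gP x))).
  rewrite opprB addrC addrA subrK.
  by rewrite -sumrB; apply: eq_bigr => i _; rewrite scalerBl.
have glin : linear g.
  move=> k a b; apply: guniq.
  apply: (mem_eq (subspD Ss (subspZ k Ss (gP a)) (gP b))).
  rewrite scalerBr addrACA -opprD scaler_sumr -big_split; congr (_ - _).
  by apply: eq_bigr => i _; rewrite !mxE scalerDl scalerA.
pose gm := GRing.isLinear.Build K L 'rV[K]_n _ g glin.
pose gL : {linear L -> 'rV[K]_n} := HB.pack g gm.
exists n, gL; split=> [z|v].
  split=> [Sz|/= gz].
    by apply: guniq; rewrite big1 ?subr0// => i _; rewrite mxE scale0r.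
  have := gP z; rewrite gz big1 ?subr0// => i _; by rewrite mxE scale0r.
by exists (\sum_(i < n) v 0 i *: e i); apply: guniq; rewrite subrr; exact: subsp0.
Qed.

Lemma adapted_eq n S (f : L -> 'rV[K]_n) : adapted S f -> S = [set z | f z = 0].
Proof. by move=> fS; apply/seteqP; split=> z /fS. Qed.

Lemma finite_codimS S B : S `<=` B -> finite_codim S -> finite_codim B.
Proof. by move=> SB [n [e eP]]; exists n, e => x; have [c /SB] := eP x; exists c. Qed.

Lemma finite_codimI S B : is_subspace S -> is_subspace B ->
  finite_codim S -> finite_codim B -> finite_codim (S `&` B).
Proof.
move=> Ss Bs /(finite_codim_surj Ss)[n [f [fS _]]].
move=> /(finite_codim_surj Bs)[m [g [gB _]]].
have hl : linear (fun z => row_mx (f z) (g z)).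
  by move=> k a b; rewrite !linearP /= scale_row_mx add_row_mx.
pose gm := GRing.isLinear.Build K L 'rV[K]_(n + m) _ _ hl.
pose h : {linear L -> 'rV[K]_(n + m)} := HB.pack (fun z => row_mx (f z) (g z)) gm.
apply: finite_codimS (ker_finite_codim h) => z /= hz.
have [fz gz] : f z = 0 /\ g z = 0 by apply: eq_row_mx; rewrite hz row_mx0.
by split; [apply/fS|apply/gB].
Qed.

Lemma finite_codim_preim S (D : {linear L -> L}) : is_subspace S ->
  finite_codim S -> finite_codim [set z | S (D z)].
Proof.
move=> Ss /(finite_codim_surj Ss)[n [f [fS _]]].
apply: finite_codimS (ker_finite_codim (f \o D)) => z /= fz.
by apply/fS.
Qed.

End FiniteCodim.

(** * Generalized eigenspaces of an operator modulo a stable subspace *)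

Section GeneralizedEigenspaces.
Context (K : numFieldType) (L : lieAlgType K).
Variables (D : {linear L -> L}) (S : set L).
Hypotheses (Ss : is_subspace S) (DS : forall z, S z -> S (D z)).

Definition shift (a : K) (z : L) : L := D z - a *: z.

Lemma shift_linear a : linear (shift a).
Proof.
move=> k x y; rewrite /shift linearP scalerDr opprD addrACA scalerBr.
by rewrite !scalerA mulrC.
Qed.

HB.instance Definition _ a :=
  GRing.isLinear.Build K L L _ (shift a) (shift_linear a).

Lemma shift_stable a z : S z -> S (shift a z).
Proof. by move=> Sz; apply: subspB => //; [exact: DS|exact: subspZ]. Qed.

Lemma shiftE a b z : shift b z = shift a z + (a - b) *: z.
Proof. by rewrite /shift scalerBl addrA subrK. Qed.

(** The preimage in L of the generalized [a]-eigenspace of [D] on L/S. *)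
Definition geig (a : K) : set L := [set z | exists n, S (iter n (shift a) z)].

Lemma sub_geig a z : S z -> geig a z.
Proof. by exists 0%N. Qed.

Lemma iter_shift_stable n a z : S z -> S (iter n (shift a) z).
Proof. by move=> Sz; elim: n => // n; exact: shift_stable. Qed.

Lemma geig_subsp a : is_subspace (geig a).
Proof.
split=> [|k x y [m Sx] [n Sy]]; first by apply: sub_geig; exact: subsp0.
exists (m + n)%N.
have -> : iter (m + n) (shift a) (k *: x + y) =
    k *: iter n (shift a) (iter m (shift a) x) +
    iter m (shift a) (iter n (shift a) y).
  rewrite -!iterD [(n + m)%N]addnC; elim: (m + n)%N => //= i ->.
  by rewrite linearP.
by apply: subspD => //; [apply: subspZ => //|]; exact: iter_shift_stable.
Qed.

Lemma geig_shift a z : geig a (shift a z) -> geig a z.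
Proof. by move=> [n Sn]; exists n.+1; rewrite iterSr. Qed.

Lemma shift_geig a z : geig a z -> geig a (shift a z).
Proof. by case=> n Sn; exists n; rewrite -iterSr; exact: shift_stable. Qed.

(** On [geig a] the operator D - b is the nonzero scalar a - b plus D - a, which is nilpotent modulo
    [S]; the inverse is built by induction on the nilpotency exponent. *)
Lemma shift_onto a b z : a != b -> geig a z ->
  exists2 w, geig a w & S (shift b w - z).
Proof.
move=> ab [n]; elim: n z => [|n IH] z Sz.
  exists 0; first by apply: sub_geig; exact: subsp0.
  by rewrite linear0 sub0r; exact: subspN.
have [w aw Sw] := IH (shift a z) ltac:(by rewrite -iterSr).
have az : geig a z by exists n.+1.
have ba : a - b != 0 by rewrite subr_eq0.
exists ((a - b)^-1 *: (z - w)).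
  by apply: (subspZ _ (geig_subsp a)); exact: (subspB (geig_subsp a)).
rewrite linearZ linearB /=.
apply: (mem_eq (subspN Ss (subspZ (a - b)^-1 Ss Sw))).
rewrite -scalerN -[X in _ = _ - X](scalerK ba) -scalerBr; congr (_ *: _).
by rewrite (shiftE a b z) [RHS]addrAC addrK opprB.
Qed.

Fixpoint shifts (s : seq K) (z : L) : L :=
  if s is a :: s' then shifts s' (shift a z) else z.

Definition geigs : set L := lspan [set z | exists a, geig a z].

Lemma geig_geigs a z : geig a z -> geigs z.
Proof. by move=> az; apply: sub_lspan; exists a. Qed.

(** By induction [shift a z] is in [geigs]. By [shift_onto], D - a maps [geigs] onto itself up to
    [geig a], so some [w] in [geigs] has (D - a)(z - w) in [geig a], and then z - w is in
    [geig a]. *)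
Lemma shifts_geigs s z : S (shifts s z) -> geigs z.
Proof.
have gs : is_subspace geigs := lspan_subsp _.
elim: s z => [|a s IH] z /= Sz; first by apply: (@geig_geigs 0); exact: sub_geig.
have := IH _ Sz.
suff /[apply] -[w gw aw] : geigs `<=`
    [set x | exists2 w, geigs w & geig a (shift a w - x)].
  rewrite -(subrK w z); apply: (subspD gs) => //; apply: (@geig_geigs a).
  apply: geig_shift; rewrite linearB /=; rewrite -opprB.
  exact: (subspN (geig_subsp a)).
apply: lspan_sub.
  split=> [|k x y [w gw aw] [v gv av]].
    by exists 0; [exact: subsp0|rewrite linear0 subrr; exact: (sub_geig _ (subsp0 Ss))].
  exists (k *: w + v); first by apply: (subspD gs) => //; exact: (subspZ _ gs).
  rewrite linearP opprD addrACA -scalerBr.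
  by apply: (subspD (geig_subsp a)) => //; apply: (subspZ _ (geig_subsp a)).
move=> x [b bx]; have [<-|nba] := eqVneq b a.
  exists 0; first exact: subsp0.
  by rewrite linear0 sub0r; exact: (subspN (geig_subsp b)).
have [w bw Sw] := shift_onto nba bx.
by exists w; [exact: geig_geigs bw|exact: sub_geig].
Qed.

Lemma shifts_eigenvector s a v : S (shift a v) ->
  S (shifts s v - \prod_(b <- s) (a - b) *: v).
Proof.
elim: s v => [|b s IH] v Sv /=; first by rewrite big_nil scale1r subrr; exact: subsp0.
have Sv' : S (shift a (shift b v)).
  have -> : shift a (shift b v) = shift b (shift a v); last exact: shift_stable.
  by rewrite [RHS](shiftE a b) [in LHS](shiftE a b v) linearD linearZ.
apply: (mem_eq (subspD Ss (IH _ Sv') (subspZ (\prod_(c <- s) (a - c)) Ss Sv))).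
rewrite -addrA; congr (_ + _); rewrite big_cons [_ * \prod_(_ <- _) _]mulrC -scalerA.
rewrite -scalerN -scalerDr -scalerN; congr (_ *: _).
by rewrite (shiftE a b v) opprD addrC addNKr.
Qed.

(** An eigenvector modulo [S] with eigenvalue [a] is multiplied by the product of the a - b, which
    is nonzero: all eigenvalues on L/S are roots of the annihilating product. *)
Lemma shifts_injective s a v : (forall z, S (shifts s z)) -> a \notin s ->
  S (shift a v) -> S v.
Proof.
move=> Ss0 as_ Sv; have := subspB Ss (Ss0 v) (shifts_eigenvector s Sv).
rewrite opprB addrC subrK.
have p0 : \prod_(b <- s) (a - b) != 0.
  rewrite prodf_seq_neq0; apply/allP => b bs /=; rewrite subr_eq0.
  by apply: contraNneq as_ => ->.
by move=> /(subspZ (\prod_(b <- s) (a - b))^-1 Ss); rewrite scalerK.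
Qed.

Lemma geig_injective s a v : (forall z, S (shifts s z)) -> a \notin s ->
  geig a v -> S v.
Proof.
move=> Ss0 as_ [n]; elim: n => // n IH Sn; apply: IH.
exact: shifts_injective Ss0 as_ Sn.
Qed.

End GeneralizedEigenspaces.

(** * Splitting of L/S over an algebraically closed field *)

Section Splitting.
Context (K : numClosedFieldType) (L : lieAlgType K).
Variables (D : {linear L -> L}) (S : set L).
Hypotheses (Ss : is_subspace S) (DS : forall z, S z -> S (D z)).
Hypothesis Sf : finite_codim S.

(** Cayley-Hamilton for the matrix of [D] on L/S, with the characteristic polynomial split into
    linear factors. *)
Lemma finite_codim_shifts : exists s : seq K, forall z, S (shifts D s z).
Proof.
have [n [f [fS fs]]] := finite_codim_surj Ss Sf.
(* Codimension 0 is separate: evaluating a polynomial at a matrix uses the ring of square matrices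
   of positive size. *)
case: n => [|n] in f fS fs *.
  by exists [::] => z; apply/fS; rewrite [f z]thinmx0.
have /choice[g gK] : forall v, exists x, f x = v by [].
pose A := \matrix_(i < n.+1) f (D (g (delta_mx 0 i))).
have fA z : f (D z) = f z *m A.
  have Sz : S (z - \sum_i f z 0 i *: g (delta_mx 0 i)).
    apply/fS; rewrite linearB linear_sum /=.
    under eq_bigr do rewrite linearZ /= gK.
    by rewrite -row_sum_delta subrr.
  have /DS/fS := Sz.
  have -> : D (z - \sum_i f z 0 i *: g (delta_mx 0 i)) =
      D z - \sum_i f z 0 i *: D (g (delta_mx 0 i)).
    by rewrite linearB linear_sum; under eq_bigr do rewrite linearZ.
  rewrite linearB linear_sum => /eqP.
  rewrite subr_eq0 => /eqP ->; rewrite mulmx_sum_row; apply: eq_bigr => i _.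
  by rewrite linearZ rowK.
have [s sE] := closed_field_poly_normal (char_poly A).
exists s => z; apply/fS.
have -> : f (shifts D s z) = f z *m horner_mx A (\prod_(b <- s) ('X - b%:P)).
  elim: (s) z => [|a t IH] z /=; first by rewrite big_nil rmorph1 mulmx1.
  rewrite IH big_cons rmorphM /= mulmxA; congr (_ *m _).
  rewrite rmorphB /= horner_mx_X horner_mx_C mulmxBr mul_mx_scalar -fA.
  by rewrite /shift linearB linearZ.
have := Cayley_Hamilton A; rewrite sE (monicP (char_poly_monic A)) scale1r => ->.
by rewrite mulmx0.
Qed.

Lemma geigs_full z : geigs D S z.
Proof. by have [s sP] := finite_codim_shifts; exact: shifts_geigs (sP z). Qed.

End Splitting.

(** * The filtration of a subalgebra and words in the adjoint action *)

Section Filtration.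
Context (K : numFieldType) (L : lieAlgType K) (M : set L).
Hypothesis Ma : is_lie_subalgebra M.
Let Ms : is_subspace M := Ma.1.

Fixpoint filt (k : nat) : set L :=
  if k is j.+1 then [set z | filt j z /\ forall y, filt j (lie y z)] else M.

Lemma filt_subsp k : is_subspace (filt k).
Proof.
elim: k => [|k IH]//=; split=> [|c a b [Sa La] [Sb Lb]].
  by split=> [|y]; rewrite ?linear0; exact: subsp0.
split=> [|y]; first exact: (subspD IH (subspZ _ IH _)).
by rewrite lie_linearr; exact: (subspD IH (subspZ c IH (La y)) (Lb y)).
Qed.

Lemma filt_le j k z : (j <= k)%N -> filt k z -> filt j z.
Proof.
move=> /subnK <-; elim: (k - j)%N => [|i IH]; rewrite ?add0n ?addSn //= => -[+ _].
exact: IH.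
Qed.

Lemma filt_sub k z : filt k z -> M z.
Proof. exact: (@filt_le 0). Qed.

Lemma filt_lie k y z : filt k.+1 z -> filt k (lie y z).
Proof. by case=> _; exact. Qed.

Lemma filt_liel k y z : filt k.+1 z -> filt k (lie z y).
Proof.
by move=> kz; rewrite lieC; apply: (subspN (filt_subsp k)); exact: filt_lie.
Qed.

(** Bracketing with M costs no filtration step: in [y,[m,z]] = [[y,m],z] + [m,[y,z]] the first term
    is controlled by z, the second by induction. *)
Lemma filt_lieM k m z : M m -> filt k z -> filt k (lie m z).
Proof.
move=> Mm; elim: k z => [|k IH] z /=; first exact: Ma.2.
move=> [kz Lz]; split=> [|y]; first exact: IH.
rewrite lieA; apply: (subspD (filt_subsp k)); first exact: Lz.
by apply: IH; exact: Lz.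
Qed.

Lemma iter_lie_filt j k x z : filt (k + j) z -> filt k (iter j (lie x) z).
Proof.
elim: j k => [|j IH] k; first by rewrite addn0.
by rewrite addnS -addSn => /IH; exact: filt_lie.
Qed.

Lemma ideal_filt J k : is_lie_ideal J -> J `<=` M -> J `<=` filt k.
Proof.
move=> [Js Jl] JM; elim: k => //= k IH z Jz.
by split=> [|y]; [exact: IH|apply: IH; exact: Jl].
Qed.

Lemma filt_finite_codim k : finite_codim M -> finite_codim (filt k).
Proof.
move=> Mf; elim: k => //= k IH; have [n [e eP]] := Mf.
(* Since M preserves [filt k], the condition on [y,z] has to be tested only for the finitely many
   [y] that span L modulo M. *)
pose C (s : seq L) := [set z | filt k z /\ forall y, y \in s -> filt k (lie y z)].
suff CP s : is_subspace (C s) /\ finite_codim (C s).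
  apply: (finite_codimS _ (CP (codom e)).2) => z [kz Cz]; split=> // y.
  have [c My] := eP y; rewrite -(subrK (\sum_(i < n) c i *: e i) y) lieDl.
  apply: (subspD (filt_subsp k)); first exact: filt_lieM.
  rewrite lie_suml; apply: (subsp_sum _ (filt_subsp k)) => i _.
  by rewrite lieZl; apply: (subspZ _ (filt_subsp k)); apply: Cz; exact: codom_f.
elim: s => [|y s [Cs Cf]].
  have -> : C [::] = filt k by apply/seteqP; split=> z => [[]|].
  by split=> //; exact: filt_subsp.
have -> : C (y :: s) = C s `&` [set z | filt k (lie y z)].
  apply/seteqP; split=> z /= [].
    move=> kz Cz; split; last by apply: Cz; rewrite inE eqxx.
    by split=> // x xs; apply: Cz; rewrite inE xs orbT.
  by move=> [kz Cz] yz; split=> // x; rewrite inE => /predU1P[->//|]; exact: Cz.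
have ps := subsp_preim (lie y) (filt_subsp k).
split; last by apply: finite_codimI => //; exact: finite_codim_preim (filt_subsp k) _.
split=> [|c a b [Ca ya] [Cb yb]]; first by split; exact: subsp0.
by split; [apply: (subspD Cs) => //; exact: subspZ|
           apply: (subspD ps) => //; exact: (subspZ _ ps)].
Qed.

Definition word (w : seq L) (z : L) : L := foldr (fun x => lie x) z w.

Lemma word_cat w1 w2 z : word (w1 ++ w2) z = word w1 (word w2 z).
Proof. by rewrite /word foldr_cat. Qed.

Lemma word_linear w : linear (word w).
Proof. by move=> c a b; elim: w => //= x w ->; rewrite linearP. Qed.

HB.instance Definition _ w :=
  GRing.isLinear.Build K L L _ (word w) (word_linear w).

Lemma word_filt j w z : filt (j + size w) z -> filt j (word w z).
Proof.
elim: w j z => [|x w IH] j z; first by rewrite addn0.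
by rewrite /= addnS -addSn => /IH; exact: filt_lie.
Qed.

Lemma filt_words k z :
  (forall w, (size w <= k)%N -> M (word w z)) -> filt k z.
Proof.
elim: k z => [|k IH] z wz; first exact: (wz [::]).
split=> [|y]; apply: IH => w wk; first by apply: wz; exact: leqW.
by have := wz (rcons w y); rewrite size_rcons ltnS -cats1 word_cat; exact.
Qed.

(** Nilpotency of ad x up to the filtration. As [filt k] need not be stable under ad x, the
    condition is put on values in L and not on an operator of a quotient. *)
Definition adnil N k (x : L) := forall z, filt k (iter N (lie x) z).

Lemma adnil_ge N k x j z : adnil N k x -> (N <= j)%N -> filt k (iter j (lie x) z).
Proof. by move=> xn /subnKC <-; rewrite iterD; exact: xn. Qed.

Lemma adnil_le N k j x : (j <= k)%N -> adnil N k x -> adnil N j x.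
Proof. by move=> jk xn z; exact: filt_le jk (xn z). Qed.

End Filtration.

(** * Truncated exponentials of ad-nilpotent elements *)

Lemma sum_triangle (V : zmodType) n (F : nat -> nat -> V) :
  \sum_(i < n) \sum_(j < n) F i j =
  \sum_(k < n) \sum_(i < k.+1) F i (k - i)%N +
  \sum_(i < n) \sum_(j < n | (n <= i + j)%N) F i j.
Proof.
under eq_bigr => i _ do rewrite (bigID (fun j : 'I_n => (n <= i + j)%N)) /= addrC.
rewrite big_split; congr (_ + _).
transitivity (\sum_(i < n) \sum_(k < n | (i <= k)%N) F i (k - i)%N).
  apply: eq_bigr => i _.
  rewrite -(big_geq_mkord _ _ xpredT (fun k => F i (k - i)%N)).
  rewrite -[X in \big[_/_]_(X <= _ < _ | _) _]add0n big_addn big_mkord.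
  rewrite (big_ord_widen_cond n xpredT (fun j => F i (j + i - i)%N)) ?leq_subr//.
  apply: eq_big => j; last by rewrite addnK.
  by rewrite -ltnNge ltn_subRL.
rewrite (exchange_big_dep xpredT) //=; apply: eq_bigr => k _.
by rewrite (big_ord_widen_cond n xpredT (fun i => F i (k - i)%N)).
Qed.

(** Replacing p(t) by p(2t) - 2^n p(t) removes the coefficient of degree n and multiplies the one of
    degree i by 2^i - 2^n, which is nonzero for i < n. *)
Lemma polynomial_coefs (K : numFieldType) (L : lieAlgType K) (B : set L) n
    (v : nat -> L) : is_subspace B ->
  (forall t : K, B (\sum_(i < n) t ^+ i *: v i)) ->
  forall i, (i < n)%N -> B (v i).
Proof.
move=> Bs; elim: n v => // n IH v Bv.
have Bi i : (i < n)%N -> B (v i).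
  move=> lin; have c0 : (2 ^+ i - 2 ^+ n : K) != 0.
    by rewrite subr_eq0 lt_eqF// ltr_eXn2l// ltr1n.
  rewrite -(scalerK c0 (v i)); apply: (subspZ _ Bs).
  apply: (IH (fun i => (2 ^+ i - 2 ^+ n) *: v i)) => // t.
  apply: (mem_eq (subspB Bs (Bv (2 * t)) (subspZ (2 ^+ n) Bs (Bv t)))).
  rewrite scaler_sumr -sumrB big_ord_recr /= scalerA exprMn subrr addr0.
  by apply: eq_bigr => j _; rewrite !scalerA -scalerBl exprMn mulrBr mulrC [t ^+ _ * 2 ^+ n]mulrC.
move=> i; rewrite ltnS leq_eqVlt => /predU1P[->|/Bi//].
have Bsum : B (\sum_(j < n) v j) by apply: (subsp_sum _ Bs) => j _; exact: Bi.
apply: (mem_eq (subspB Bs (Bv 1) Bsum)).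
rewrite big_ord_recr /= expr1n scale1r addrAC.
by under eq_bigr do rewrite expr1n scale1r; rewrite subrr add0r.
Qed.

Section Exponential.
Context (K : numFieldType) (L : lieAlgType K) (x : L).

(** The term of degree [i] of exp(t ad x) z. *)
Definition divpow (t : K) (i : nat) (z : L) : L :=
  (t ^+ i / i`!%:R) *: iter i (lie x) z.

Lemma iter_lie_linear i : linear (iter i (lie x)).
Proof. by move=> k a b; elim: i => //= i ->; rewrite linearP. Qed.

HB.instance Definition _ i :=
  GRing.isLinear.Build K L L _ (iter i (lie x)) (iter_lie_linear i).

Lemma divpow_linear t i : linear (divpow t i).
Proof.
move=> k a b; rewrite /divpow linearP scalerDr; congr (_ + _).
by rewrite !scalerA mulrC.
Qed.

HB.instance Definition _ t i :=
  GRing.isLinear.Build K L L _ (divpow t i) (divpow_linear t i).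

Lemma divpowS t i z : i.+1%:R *: divpow t i.+1 z = t *: lie x (divpow t i z).
Proof.
rewrite /divpow [in RHS]linearZ /= !scalerA; congr (_ *: _).
have c0 : (i.+1%:R : K) != 0 by rewrite pnatr_eq0.
have f0 : (i`!%:R : K) != 0 by rewrite pnatr_eq0 -lt0n fact_gt0.
rewrite factS natrM exprS; move: (i.+1%:R) (i`!%:R) (t ^+ i) c0 f0 => c f u c0 f0.
by field; rewrite c0 f0.
Qed.

(** Leibniz rule for the divided powers of the derivation t ad x, by induction on [k] after
    multiplication by k + 1. *)
Lemma divpow_lie t k a b : divpow t k (lie a b) =
  \sum_(i < k.+1) lie (divpow t i a) (divpow t (k - i) b).
Proof.
elim: k => [|k IH].
  by rewrite big_ord1 /divpow /= expr0 fact0 divr1 !scale1r.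
have k0 : (k.+1%:R : K) != 0 by rewrite pnatr_eq0.
have step i : t *: lie x (lie (divpow t i a) (divpow t (k - i) b)) =
    i.+1%:R *: lie (divpow t i.+1 a) (divpow t (k - i) b) +
    (k - i).+1%:R *: lie (divpow t i a) (divpow t (k - i).+1 b).
  by rewrite lieA scalerDr -lieZl -divpowS lieZl -[t *: _]lieZr -divpowS (lieZr (k - i).+1%:R).
apply: (scalerI k0); rewrite divpowS IH linear_sum scaler_sumr.
under eq_bigr => i _ do rewrite step.
rewrite big_split /= scaler_sumr.
(* Splitting k + 1 as i + (k + 1 - i) separates the terms coming from ad x on the left factor from
   those on the right one. *)
under [RHS]eq_bigr => i _ do
  rewrite -{1}(subnKC (leq_ord i)) natrD scalerDl.
rewrite big_split /=; congr (_ + _).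
  rewrite [RHS]big_ord_recl /= scale0r add0r; apply: eq_bigr => i _.
  by rewrite /bump add1n subSS.
rewrite [RHS]big_ord_recr /= subnn scale0r addr0; apply: eq_bigr => i _.
by rewrite subSn// leq_ord.
Qed.

(** The part of degree [k] of exp(t ad x) exp(- t ad x), namely (t - t)^k / k! times (ad x)^k by the
    binomial formula. *)
Lemma divpow_opp t k z :
  \sum_(i < k.+1) divpow t i (divpow (- t) (k - i) z) = if k is 0 then z else 0.
Proof.
have E (i : 'I_k.+1) : divpow t i (divpow (- t) (k - i) z) =
    (k`!%:R^-1 * ((- t) ^+ (k - i) * t ^+ i *+ 'C(k, i))) *: iter k (lie x) z.
  rewrite /divpow linearZ /= scalerA -iterD subnKC ?leq_ord//.
  congr (_ *: _); rewrite -[_ *+ 'C(k, i)]mulr_natr.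
  have := bin_fact (leq_ord i) => /(congr1 (fun n => n%:R : K)).
  rewrite !natrM => <-.
  have i0 : (i`!%:R : K) != 0 by rewrite pnatr_eq0 -lt0n fact_gt0.
  have j0 : ((k - i)`!%:R : K) != 0 by rewrite pnatr_eq0 -lt0n fact_gt0.
  have b0 : ('C(k, i)%:R : K) != 0 by rewrite pnatr_eq0 -lt0n bin_gt0 leq_ord.
  move: (t ^+ i) ((- t) ^+ (k - i)) (i`!%:R : K) ((k - i)`!%:R : K) ('C(k, i)%:R : K) i0 j0 b0.
  by move=> u v c d e c0 d0 e0; field; rewrite c0 d0 e0.
under eq_bigr do rewrite E.
rewrite -scaler_suml -mulr_sumr -exprDn addNr.
case: k {E} => [|k]; last by rewrite expr0n mulr0 scale0r.
by rewrite fact0 invr1 mul1r scale1r.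
Qed.

(** Used with [n = N + N]: indices with i + j >= N + N have i >= N or j >= N, so the truncation
    errors in products lie in the filtration. *)
Definition texp n (t : K) (z : L) : L := \sum_(i < n) divpow t i z.

Lemma texp_linear n t : linear (texp n t).
Proof.
move=> k a b; rewrite /texp scaler_sumr -big_split.
by apply: eq_bigr => i _; rewrite linearP.
Qed.

HB.instance Definition _ n t :=
  GRing.isLinear.Build K L L _ (texp n t) (texp_linear n t).

Variable M : set L.
Hypothesis Ma : is_lie_subalgebra M.
Variable N : nat.

Lemma divpow_filt k t i z : adnil M N k x -> (N <= i)%N ->
  filt M k (divpow t i z).
Proof. by move=> xn Ni; apply: (subspZ _ (filt_subsp Ma k)); exact: adnil_ge Ni. Qed.

(** The terms of total degree below 2N cancel by the Leibniz rule. Each remaining one has a factor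
    in [filt M k.+1], and the bracket lowers the level by one. *)
Lemma texp_lie k t a b : adnil M N k.+1 x ->
  filt M k (lie (texp (N + N) t a) (texp (N + N) t b) - texp (N + N) t (lie a b)).
Proof.
move=> xn; rewrite /texp lie_suml.
under eq_bigr do rewrite linear_sum.
rewrite (sum_triangle _ (fun i j => lie (divpow t i a) (divpow t j b))).
under [X in _ - X]eq_bigr do rewrite divpow_lie.
rewrite addrAC subrr add0r.
apply: (subsp_sum _ (filt_subsp Ma k)) => i _.
apply: (subsp_sum _ (filt_subsp Ma k)) => j ij.
have [Ni|iN] := leqP N i.
  by apply: (filt_liel Ma); exact: divpow_filt.
apply: filt_lie; apply: divpow_filt => //.
by rewrite -(leq_add2l i); apply: leq_trans ij; rewrite leq_add2r ltnW.
Qed.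

Lemma texp_opp k t z : adnil M N k x ->
  filt M k (texp (N + N) t (texp (N + N) (- t) z) - z).
Proof.
move=> xn; have ks := filt_subsp Ma k.
(* For N = 0 the truncated sum is empty, but then [filt M k] is all of L. *)
case: (posnP N) => [N0|N0].
  have kT u : filt M k u by have := xn u; rewrite N0.
  exact: kT.
rewrite /texp; under eq_bigr do rewrite linear_sum.
rewrite (sum_triangle _ (fun i j => divpow t i (divpow (- t) j z))).
under eq_bigr do rewrite divpow_opp.
case: N N0 xn => // N' _ xn.
rewrite [\sum_(_ < N'.+1 + _) _]big_ord_recl big1// addr0 addrAC subrr add0r.
apply: (subsp_sum _ ks) => i _; apply: (subsp_sum _ ks) => j ij.
rewrite {2}/divpow linearZ /divpow /= scalerA -iterD.
apply: (subspZ _ ks); apply: adnil_ge xn _.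
by apply: leq_trans ij; rewrite leq_addr.
Qed.

(* exp(t ad x) is an automorphism of L only up to the filtration, whence the
   loss of 2N steps. *)
Lemma adnil_texp k t y : adnil M N (k + N + N).+1 x -> adnil M N (k + N + N) y ->
  adnil M N k (texp (N + N) t y).
Proof.
move=> xn yn z; set E := texp (N + N) t; have ks := filt_subsp Ma.
have EN j m b : adnil M N (m + j).+1 x ->
    filt M m (iter j (lie (E y)) (E b) - E (iter j (lie y) b)).
  elim: j m b => [|j IH] m b xm /=; first by rewrite subrr; exact: subsp0 (ks m).
  have -> : lie (E y) (iter j (lie (E y)) (E b)) - E (lie y (iter j (lie y) b)) =
    lie (E y) (iter j (lie (E y)) (E b) - E (iter j (lie y) b)) +
    (lie (E y) (E (iter j (lie y) b)) - E (lie y (iter j (lie y) b))).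
    by rewrite linearB addrA subrK.
  apply: (subspD (ks m)).
    by apply: filt_lie; apply: IH; rewrite addSnnS.
  by apply: texp_lie; apply: adnil_le xm; rewrite ltnS leq_addr.
have xk : adnil M N (k + N) x by apply: adnil_le xn => //; rewrite leqW// leq_addr.
(* With w = exp(- t ad x) z, the element z equals E w up to [filt M (k + N)], and N brackets bring
   this error into [filt M k]. *)
have := texp_opp t z xk; rewrite -/E; move: (texp _ _ z) => w wz.
rewrite -[z](subKr (E w)) opprB.
have -> : iter N (lie (E y)) (E w + (z - E w)) =
   iter N (lie (E y)) (E w) + iter N (lie (E y)) (z - E w).
  elim: (N) => //= i ->; by rewrite linearD.
apply: (subspD (ks k)).
  apply: (subsp_subr (ks k) (EN N k w _)).
    by apply: adnil_le xn => //; rewrite ltnS leq_addr.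
  rewrite /E /texp; apply: (subsp_sum _ (ks k)) => i _.
  apply: (subspZ _ (ks k)); apply: iter_lie_filt.
  apply: filt_le (yn _); rewrite -addnA leq_add2l; exact: ltnW (ltn_ord i).
apply: iter_lie_filt; rewrite -opprB; exact: (subspN (ks _)).
Qed.

(** [x,y] is the coefficient of t in exp(t ad x) y, all of whose values are ad-nilpotent; the index
    1 is within the truncation once N > 0. *)
Lemma lie_adnil_span k y : adnil M N (k + N + N).+1 x ->
  adnil M N (k + N + N) y -> lspan (adnil M N k) (lie x y).
Proof.
move=> xn yn; have ls := lspan_subsp (adnil M N k : set L).
case: (posnP N) => [N0|N0].
  apply: sub_lspan => z.
  have /filt_le : filt M (k + N + N).+1 (iter N (lie (lie x y)) z).
    have E u : iter N (lie x) u = u by rewrite N0.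
    by have := xn (iter N (lie (lie x y)) z); rewrite E.
  by apply; rewrite leqW// -addnA leq_addr.
apply: (mem_eq (polynomial_coefs (n := N + N)
    (v := fun i => i`!%:R^-1 *: iter i (lie x) y) ls _ (i := 1%N) _)) => //.
- move=> t; apply: sub_lspan; apply: (mem_eq (adnil_texp t xn yn)).
  by apply: eq_bigr => i _; rewrite scalerA.
- by rewrite (leq_add N0 N0).
- by rewrite invr1 scale1r.
Qed.

End Exponential.

(** * Weights of an element of M and generation by ad-nilpotent elements *)

Section Weights.
Context (K : numClosedFieldType) (L : lieAlgType K) (M : set L).
Hypothesis Ma : is_lie_subalgebra M.
Hypothesis Mf : finite_codim M.
Variables (h : L) (Mh : M h).

Local Notation F := (filt M).

Definition wt k (a : K) : set L := geig (lie h) (F k) a.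

Lemma filt_lieh k z : F k z -> F k (lie h z).
Proof. exact: filt_lieM. Qed.

Lemma wt_subsp k a : is_subspace (wt k a).
Proof. exact: geig_subsp (filt_subsp Ma k) (@filt_lieh k) a. Qed.

Lemma wt_le j k a z : (j <= k)%N -> wt k a z -> wt j a z.
Proof. by move=> jk [n nz]; exists n; exact: filt_le nz. Qed.

Lemma wt_full k z : lspan [set z | exists a, wt k a z] z.
Proof.
apply: geigs_full; [exact: filt_subsp|exact: filt_lieh|].
exact: filt_finite_codim.
Qed.

Lemma wt_lieh k a z : wt k a z -> wt k a (lie h z).
Proof.
move=> az; rewrite -(subrK (a *: z) (lie h z)).
apply: (subspD (wt_subsp k a)); last exact: (subspZ _ (wt_subsp k a)).
exact: (shift_geig (filt_subsp Ma k) (@filt_lieh k)).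
Qed.

Lemma shift_lie a b x y : shift (lie h) (a + b) (lie x y) =
  lie (shift (lie h) a x) y + lie x (shift (lie h) b y).
Proof.
rewrite /shift /= lieA lieBl lieZl linearB /= lieZr scalerDl opprD.
by rewrite [RHS]addrACA.
Qed.

(** By [shift_lie] the shift by a + b of [x,y] is a sum of two brackets with smaller exponents; a
    factor in [filt M k.+1] ends the induction and accounts for the lost level. *)
Lemma wt_lie k a b x y : wt k.+1 a x -> wt k.+1 b y -> wt k (a + b) (lie x y).
Proof.
move=> [m mx] [n ny]; have ks := filt_subsp Ma k.
elim: m x mx y n ny => [|m IHm] x mx y n ny.
  by apply: sub_geig; exact: filt_liel mx.
elim: n y ny => [|n IHn] y ny; first by apply: sub_geig; exact: filt_lie ny.
apply: geig_shift; rewrite shift_lie; apply: (subspD (wt_subsp k _)).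
  by apply: (IHm _ _ _ n.+1) => //; rewrite -iterSr.
by apply: IHn; rewrite -iterSr.
Qed.

Variable c : K.
Hypothesis c0 : 0 <= c.
(* In a Banach Lie algebra the eigenvalues of ad h on the finite-dimensional
   quotients are bounded by the norm of ad h. *)
Hypothesis ch : forall k a z, c < `|a| -> F k (shift (lie h) a z) -> F k z.

Lemma wt_large k a z : c < `|a| -> wt k a z -> F k z.
Proof. by move=> ca [n]; elim: n => // n IH nz; apply: IH; exact: ch nz. Qed.

(** Let z have weight b. If |b| > c, then z already lies in the filtration; otherwise (ad x)^N z has
    weight b + N a, of modulus at least N|a| - c > c. The bound on N does not involve k. *)
Lemma wt_adnil N k a x : c + c < N%:R * `|a| -> wt (k + N) a x -> adnil M N k x.
Proof.
move=> cN ax z; have ks := filt_subsp Ma k.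
have iter_lin : is_subspace [set z | F k (iter N (lie x) z)].
  exact: (subsp_preim (iter N (lie x)) ks).
apply: (@wt_full (k + N) z _ iter_lin) => {}z [b bz].
have iz j m : (m + j = k + N)%N -> wt m (b + j%:R * a) (iter j (lie x) z).
  elim: j m => [|j IH] m; first by rewrite addn0 => ->; rewrite mul0r addr0.
  rewrite addnS -addSn => mj; have := IH _ mj.
  rewrite -natr1 mulrDl mul1r addrA [_ + a]addrC; apply: wt_lie.
  by apply: wt_le ax; rewrite -mj leq_addr.
have [bc|cb] := real_leP (normr_real b) (ger0_real c0).
  apply: wt_large (iz N k erefl).
  rewrite -(ltrD2l c); apply: lt_le_trans cN _.
  have -> : N%:R * `|a| = `|- b + (b + N%:R * a)|.
    by rewrite addKr normrM normr_nat.
  by apply: le_trans (ler_normD _ _) _; rewrite normrN lerD2r.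
by apply: iter_lie_filt; exact: wt_large bz.
Qed.

Hypothesis Mmax : forall B, is_lie_subalgebra B -> M `<=` B -> B = M \/ B = setT.

Definition wt_gens k : set L := [set g | exists a, a != 0 /\
  (wt k a g \/ exists x y, [/\ wt k a x, wt k (- a) y & g = lie x y])].

Definition wt_hull k : set L := lspan (M `|` wt_gens k).

Lemma wt_gens_le j k g : (j <= k)%N -> wt_gens k g -> wt_gens j g.
Proof.
move=> jk [a [a0 [ag|[x [y [ax ay gE]]]]]]; exists a; split=> //.
  by left; exact: wt_le ag.
by right; exists x, y; split=> //; exact: wt_le jk _.
Qed.

(** For z of weight b and g of weight a, [z,g] has weight a + b or is a bracket of opposite weights.
    For g = [x,y] of weight 0, [z,g] has weight b if b is nonzero; if b = 0, the Jacobi identity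
    moves z onto x and y and keeps their weights. *)
Lemma lie_wt_gens k z g : wt_gens k.+2 g -> wt_hull k (lie z g).
Proof.
move=> [a [a0 ag]]; have hs := lspan_subsp (M `|` wt_gens k).
have gensP u : wt_gens k u -> wt_hull k u.
  by move=> ku; apply: sub_lspan; right.
have ls : is_subspace [set z | wt_hull k (lie z g)].
  split=> [|d u v /= hu hv]; first by rewrite /= lie0l; exact: subsp0.
  by rewrite lie_linearl; apply: (subspD hs) => //; exact: (subspZ _ hs).
apply: (@wt_full k.+2 z _ ls) => {}z [b bz] /=.
case: ag => [ag|[x [y [ax ay ->]]]].
  have [ba|ba] := eqVneq (b + a) 0.
    have bE : a = - b by apply/eqP; rewrite -addr_eq0 addrC ba.
    apply: gensP; exists b; split; first by rewrite -oppr_eq0 -bE.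
    right; exists z, g; rewrite -bE.
    by split=> //; [apply: wt_le bz|apply: wt_le ag]; rewrite !leqW.
  apply: gensP; exists (b + a); split=> //; left.
  by apply: (@wt_le _ k.+1) => //; exact: wt_lie.
have [b0|b0] := eqVneq b 0; last first.
  apply: gensP; exists b; split=> //; left; rewrite -[b]addr0.
  by apply: wt_lie; [exact: wt_le bz|rewrite -(subrr a); exact: wt_lie].
rewrite lieA; apply: (subspD hs); apply: gensP; exists a; split=> //; right.
  exists (lie z x), y; split=> //; last by apply: wt_le ay; rewrite !leqW.
  by apply: (@wt_le _ k.+1) => //; rewrite -[a]add0r -b0; exact: wt_lie.
exists x, (lie z y); split=> //; first by apply: wt_le ax; rewrite !leqW.
by apply: (@wt_le _ k.+1) => //; rewrite -[- a]add0r -b0; exact: wt_lie.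
Qed.

Lemma wt_hull_lie k x y : wt_hull k.+2 x -> wt_hull k.+2 y -> wt_hull k (lie x y).
Proof.
move=> kx ky; have hs := lspan_subsp (M `|` wt_gens k).
have ls u : is_subspace [set z | wt_hull k (lie z u)].
  split=> [|d a b /= ha hb]; first by rewrite /= lie0l; exact: subsp0.
  by rewrite lie_linearl; apply: (subspD hs) => //; exact: (subspZ _ hs).
apply: (kx _ (ls y)) => {kx}x xg /=.
apply: (ky _ (subsp_preim (lie x) hs)) => {ky}y [My|yg] /=; last exact: lie_wt_gens.
case: xg => [Mx|xg]; first by apply: sub_lspan; left; exact: Ma.2.
by rewrite lieC; apply: (subspN hs); exact: lie_wt_gens.
Qed.

(* Modulo M, v is a multiple of (ad h)^n v, and for large n the latter has no
   component of weight 0. *)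
Lemma eigenvector_wt_hull k a v : a != 0 -> M (shift (lie h) a v) -> wt_hull k v.
Proof.
move=> a0 av; have hs := lspan_subsp (M `|` wt_gens k).
pose G := [set z | exists n, forall m, (n <= m)%N -> wt_hull k (iter m (lie h) z)].
have Gs : is_subspace G.
  split=> [|d x y [m mx] [n ny]].
    by exists 0%N => m _; rewrite linear0; exact: subsp0.
  exists (m + n)%N => j mnj; rewrite linearP; apply: (subspD hs).
    by apply: (subspZ _ hs); apply: mx; apply: leq_trans mnj; exact: leq_addr.
  by apply: ny; apply: leq_trans mnj; exact: leq_addl.
have [|n nv] := @wt_full k v _ Gs.
  move=> z [b bz]; have [b0|b0] := eqVneq b 0.
    have [n nz] := bz; exists n => m /subnK <-.
    apply: sub_lspan; left; rewrite iterD.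
    elim: (m - n)%N => [|j IH]; last exact: Ma.2.
    apply: (@filt_sub _ _ _ k); apply: (mem_eq nz).
    elim: (n) => //= j ->; by rewrite /shift b0 scale0r subr0.
  exists 0%N => m _; apply: sub_lspan; right; exists b; split=> //; left.
  by elim: m => //= m; exact: wt_lieh.
have := nv n (leqnn n); set u := iter n _ v => hu.
have Mu : M (u - a ^+ n *: v).
  rewrite /u; elim: (n) => [|j IH] /=.
    by rewrite expr0 scale1r subrr; exact: subsp0 Ma.1.
  apply: (mem_eq (subspD Ma.1 (Ma.2 _ _ Mh IH) (subspZ (a ^+ j) Ma.1 av))).
  rewrite linearB /= lieZr /shift scalerBr scalerA exprSr /=.
  by rewrite addrA subrK.
rewrite -(scalerK (expf_neq0 n a0) v); apply: (subspZ _ hs).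
rewrite -(subKr u (a ^+ n *: v)); apply: (subspB hs) => //.
by apply: sub_lspan; left.
Qed.

(** Brackets of hull elements lose two levels, so a single [wt_hull k] need not be a subalgebra; the
    intersection over all levels is one. It contains M and v, hence is L by maximality. *)
Lemma wt_hull_full a v k z : a != 0 -> ~ M v -> M (shift (lie h) a v) ->
  wt_hull k z.
Proof.
move=> a0 nMv av; pose B := [set z | forall k, wt_hull k z].
have hs j := lspan_subsp (M `|` wt_gens j).
have Ba : is_lie_subalgebra B.
  split=> [|x y Bx By j]; last by apply: wt_hull_lie.
  split=> [j|d x y Bx By j]; first exact: subsp0 (hs j).
  by apply: (subspD (hs j)) (By j); apply: (subspZ _ (hs j)); exact: Bx.
have Bv : B v by move=> j; exact: eigenvector_wt_hull av.
have [|BM|BT] := Mmax Ba; first by move=> x Mx j; apply: sub_lspan; left.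
  by case: nMv; rewrite -BM.
have : B z by rewrite BT.
exact.
Qed.

Hypothesis K_archi : forall x : K, 0 <= x -> exists n : nat, x < n%:R.

Lemma adnil_span a v : a != 0 -> ~ M v -> M (shift (lie h) a v) ->
  exists N, forall k z, lspan (M `|` adnil M N k) z.
Proof.
move=> a0 nMv av.
have [s sM] := finite_codim_shifts (D := lie h) Ma.1 (fun z => Ma.2 h z Mh) Mf.
(* The list [s] contains all eigenvalues of ad h on L/M; choosing N from this finite list makes it
   independent of k. *)
have [N NP] : exists N : nat, forall b, b \in s -> b != 0 -> c + c < N%:R * `|b|.
  elim: (s) => [|d t [N NP]]; first by exists 0%N.
  have [d0|d0] := eqVneq d 0.
    by exists N => b; rewrite inE => /predU1P[->|]; [rewrite d0 eqxx|exact: NP].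
  have [n nP] := K_archi (divr_ge0 (addr_ge0 c0 c0) (normr_ge0 d)).
  exists (maxn N n) => b; rewrite inE => /predU1P[-> _|bt b0].
    rewrite -ltr_pdivrMr ?normr_gt0//; apply: lt_le_trans nP _.
    by rewrite ler_nat leq_maxr.
  apply: lt_le_trans (NP b bt b0) _; apply: ler_wpM2r => //.
  by rewrite ler_nat leq_maxl.
exists N => k z.
have hs := lspan_subsp (M `|` adnil M N k).
(* [lie_adnil_span] asks for level [k'] in its first argument, and [wt_adnil] consumes N more
   levels. *)
pose k' := (k + N + N).+1.
have wtM b x j : b \notin s -> wt j b x -> M x.
  move=> bs [n /filt_sub bx].
  by apply: (geig_injective Ma.1 (fun z => Ma.2 h z Mh) sM bs); exists n.
have nilP b x j : b != 0 -> (b \in s) || (- b \in s) -> wt (j + N) b x ->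
    adnil M N j x.
  move=> b0 bs; apply: wt_adnil.
  case/orP: bs => bs; first exact: NP.
  by rewrite -normrN; apply: NP; rewrite ?oppr_eq0.
apply: (@wt_hull_full a v (k' + N) z a0 nMv av _ hs) => {}z [Mz|].
  by apply: sub_lspan; left.
move=> [b [b0 zb]].
(* If neither b nor -b is in [s], vectors of these weights lie in M. If one of them is, |b| = |-b|
   makes vectors of both weights ad-nilpotent. *)
have [bs|bs] := boolP ((b \in s) || (- b \in s)); last first.
  move: bs; rewrite negb_or => /andP[bs nbs].
  apply: sub_lspan; left.
  case: zb => [|[x [y [bx by_ ->]]]]; first exact: wtM.
  by apply: Ma.2; [exact: wtM bx|exact: wtM by_].
case: zb => [bz|[x [y [bx by_ ->]]]].
  apply: sub_lspan; right; apply: (nilP b) => //; apply: wt_le bz.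
  by rewrite leq_add2r /k' leqW// -addnA leq_addr.
apply: (lspanS (S := adnil M N k)); first by move=> u; right.
apply: lie_adnil_span => //; first exact: (nilP b).
apply: (nilP (- b)); rewrite ?oppr_eq0 ?opprK 1?orbC//.
by apply: wt_le by_; rewrite leq_add2r.
Qed.

End Weights.

(** * Rearranging words and stabilization of the filtration *)

Section Words.
Context (K : numFieldType) (L : lieAlgType K) (M : set L).
Hypothesis Ma : is_lie_subalgebra M.

Lemma word_sub (w : seq L) z : {in w, forall x, M x} -> M z -> M (word w z).
Proof.
elim: w => //= x w IH Mw Mz; apply: Ma.2; first by apply: Mw; rewrite inE eqxx.
by apply: IH => // y yw; apply: Mw; rewrite inE yw orbT.
Qed.

(** Words are multilinear in their letters, which are replaced by elements of [S] one at a time from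
    the right. *)
Lemma word_span (S : set L) p z :
  (forall w, {in w, forall x, S x} -> size w = p -> M (word w z)) ->
  forall w, {in w, forall x, lspan S x} -> size w = p -> M (word w z).
Proof.
move=> wS w0.
suff /(_ w0 [::]) : forall w v, {in w, forall x, lspan S x} ->
    {in v, forall x, S x} -> size (w ++ v) = p -> M (word (w ++ v) z).
  by rewrite cats0 => H wl; exact: H.
elim/last_ind => [|w y IH] v wl vS; first exact: wS.
rewrite cat_rcons => sz.
have wl' : {in w, forall x, lspan S x}.
  by move=> x xw; apply: wl; rewrite mem_rcons inE xw orbT.
have Ps : is_subspace [set y | M (word (w ++ y :: v) z)].
  split=> [|k a b /=]; rewrite /= !word_cat /=.
    by rewrite lie0l linear0; exact: subsp0 Ma.1.
  rewrite lie_linearl linearP => Ha Hb.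
  by apply: (subspD Ma.1) => //; exact: (subspZ _ Ma.1).
have yl : lspan S y by apply: wl; rewrite mem_rcons inE eqxx.
apply: (yl _ Ps) => {yl}x Sx /=; apply: IH => //.
  by move=> u; rewrite inE => /predU1P[->|/vS].
by rewrite -sz !size_cat.
Qed.

End Words.

Section Stabilization.
Context (K : numFieldType) (L : lieAlgType K) (M : set L).
Hypothesis Ma : is_lie_subalgebra M.
Hypothesis Mf : finite_codim M.

Lemma filt_word k w z : filt M k z -> size w = k -> M (word w z).
Proof. by move=> kz sw; apply: (@word_filt _ _ _ 0); rewrite add0n sw. Qed.

(** The two words differ by a word of length k with the letter [a,b], and words of length k send
    [filt M k] to M. *)
Lemma word_swap k z w1 w2 a b : filt M k z -> (size w1 + size w2).+1 = k ->
  M (word (w1 ++ a :: b :: w2) z) -> M (word (w1 ++ b :: a :: w2) z).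
Proof.
move=> kz sz.
have /(subspN Ma.1) : M (word (w1 ++ lie a b :: w2) z).
  by apply: (filt_word kz); rewrite size_cat /= addnS.
rewrite !word_cat /= => Mab Mw; apply: (mem_eq (subspD Ma.1 Mw Mab)).
by rewrite -linearB /= [lie a (lie b _)]lieA addrAC subrr add0r.
Qed.

Lemma word_move k z w1 w2 w3 a : filt M k z ->
  (size w1 + size w2 + size w3)%N = k ->
  M (word (w1 ++ w2 ++ a :: w3) z) -> M (word (w1 ++ a :: w2 ++ w3) z).
Proof.
move=> kz; elim/last_ind: w2 w3 => // w2 b IH w3.
rewrite size_rcons addnS => sz; rewrite !cat_rcons => Mw.
apply: (IH (b :: w3)); first by rewrite /= addnS -sz addSn.
rewrite catA; apply: (word_swap kz); first by rewrite size_cat -sz addSn.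
by rewrite -catA.
Qed.

(** A letter from M costs no filtration step, so a word of length k + 1 containing one behaves like
    a word of length k. *)
Lemma word_letter k z w1 w2 m : filt M k z -> (size w1 + size w2)%N = k -> M m ->
  M (word (w1 ++ m :: w2) z).
Proof.
move=> kz sz Mm; rewrite word_cat; apply: (@word_filt _ _ _ 0).
rewrite add0n /=; apply: filt_lieM => //.
by apply: word_filt; rewrite sz.
Qed.

Lemma word_repeated N k z w x : filt M k z -> size w = k.+1 ->
  adnil M N k.+1 x -> (N <= count_mem x w)%N -> M (word w z).
Proof.
move=> kz sw xn Nw.
(* N copies of x are gathered at the right end, where they send z into [filt M k.+1]; [j] counts the
   copies still to be moved. *)
suff /(_ N w) : forall j w, (j <= N)%N -> (size w + (N - j) = k.+1)%N ->
    (j <= count_mem x w)%N -> M (word (w ++ nseq (N - j) x) z).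
  by rewrite subnn addn0 cats0; exact.
elim=> [|j IH] {Nw sw}w jN.
  rewrite subn0 => sw _; rewrite word_cat.
  have -> : word (nseq N x) z = iter N (lie x) z by elim: (N) => //= i ->.
  apply: (@word_filt _ _ _ 0); apply: filt_le (xn z).
  by rewrite add0n -sw leq_addr.
move=> sw jw; have xw : x \in w by rewrite -has_pred1 has_count; exact: leq_trans jw.
case/splitPr: xw sw jw => w1 w2; rewrite size_cat count_cat /= eqxx => sw jw.
rewrite -catA cat_cons; apply: (word_move kz).
  by apply: succn_inj; rewrite -sw size_nseq addnS !addSn.
have := IH (w1 ++ w2) (ltnW jN).
rewrite -[(N - j)%N]prednK ?subn_gt0// -subnS /= -catA; apply.
  by rewrite -sw size_cat !addnS !addSn.
by rewrite count_cat -ltnS -addnS.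
Qed.

Lemma size_le_count (s w : seq L) N : {subset w <= s} ->
  (forall x, x \in s -> (count_mem x w <= N)%N) -> (size w <= size s * N)%N.
Proof.
elim: s w => [|x s IH] w ws wN.
  by case: w ws {wN} => // y w /(_ y); rewrite inE eqxx => /(_ isT).
rewrite -(count_predC (pred1 x) w) mulSn leq_add ?wN ?inE ?eqxx//.
rewrite -size_filter; apply: IH => [y|y ys].
  by rewrite mem_filter /= => /andP[/negbTE yx /ws]; rewrite inE yx.
rewrite count_filter; apply: leq_trans (wN y _); last by rewrite inE ys orbT.
by apply: sub_count => u /andP[].
Qed.

(** Since N serves all levels, k = nN can be fixed first, n being the codimension of M. By
    multilinearity only letters from M or from at most n ad-nilpotent elements matter; a word of
    length nN + 1 without letters from M repeats one of them at least N times. *)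
Lemma filt_stable N : (forall k z, lspan (M `|` adnil M N k) z) ->
  exists k, forall z, filt M k z -> filt M k.+1 z.
Proof.
move=> nilspan; have [n [f [fM _]]] := finite_codim_surj Ma.1 Mf.
exists (n * N)%N; set k := (n * N)%N => z kz.
have [s [sn snil _ sP]] := select_basis f (adnil M N k.+1).
apply: filt_words => // w; rewrite leq_eqVlt => /predU1P[wk|wk]; last first.
  by apply: filt_word erefl; apply: filt_le kz; rewrite -ltnS.
apply: (word_span Ma (S := M `|` [set x | x \in s]) (p := k.+1)) => //; last first.
  move=> x _; have ls := lspan_subsp (M `|` [set x | x \in s]).
  apply: (nilspan k.+1 x _ ls) => {}x [Mx|/sP[c /fM xc]].
    by apply: sub_lspan; left.
  apply: (subsp_subr ls); first by apply: sub_lspan; left; exact: xc.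
  apply: (subsp_sum _ ls) => i _; apply: (subspZ _ ls); apply: sub_lspan; right.
  exact: mem_nth.
move=> {wk}w ws wk; have [Mw|nMw] := pselect (exists2 x, x \in w & M x).
  have [x xw Mx] := Mw; case/splitPr: xw wk {ws Mw} => w1 w2.
  rewrite size_cat /= addnS => -[wk]; exact: (word_letter kz).
have {}ws : {subset w <= s}.
  by move=> x xw; case: (ws x xw) => // Mx; case: nMw; exists x.
have [x xs xN] : exists2 x, x \in s & (N <= count_mem x w)%N.
  apply: contrapT => H; have : (size w <= size s * N)%N.
    apply: size_le_count => // x xs; rewrite leqNgt; apply/negP => xN.
    by apply: H; exists x => //; exact: ltnW.
  by rewrite wk leqNgt ltnS leq_mul2r sn orbT.
exact: word_repeated kz wk (snil x xs) xN.
Qed.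

Lemma filt_stable_ideal k : (forall z, filt M k z -> filt M k.+1 z) ->
  is_lie_ideal (filt M k).
Proof.
move=> st; split; first exact: filt_subsp.
by move=> a b /st; exact: filt_lie.
Qed.

End Stabilization.

(** * Engel's theorem for the action of M on L/M *)

Section Engel.
Context (K : numFieldType) (L : lieAlgType K) (M : set L).
Hypothesis Ma : is_lie_subalgebra M.
Hypothesis Mf : finite_codim M.
Hypothesis Mnil : forall h, M h -> exists q, forall z, M (iter q (lie h) z).

(** For H contained in M: the operators ad h, h in H, generate a nilpotent associative algebra on
    L/M. *)
Definition acts_nilpotently (H : set L) := exists p, forall w z,
  {in w, forall x, H x} -> (p <= size w)%N -> M (word w z).

Definition line_hull (H : set L) (a : L) : set L :=
  [set z | exists k : K, H (z - k *: a)].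

Lemma sub_line_hull H a : H `<=` line_hull H a.
Proof. by move=> z Hz; exists 0; rewrite scale0r subr0. Qed.

Lemma mem_line_hull H a : is_subspace H -> line_hull H a a.
Proof. by move=> Hs; exists 1; rewrite scale1r subrr; exact: subsp0. Qed.

Lemma line_hull_subsp H a : is_subspace H -> is_subspace (line_hull H a).
Proof.
move=> Hs; split=> [|k x y [i Hx] [j Hy]].
  by apply: sub_line_hull; exact: subsp0.
exists (k * i + j); rewrite scalerDl opprD addrACA -scalerA -scalerBr.
by apply: (subspD Hs) => //; exact: subspZ.
Qed.

Lemma line_hull_subalgebra H a : is_lie_subalgebra H ->
  (forall h, H h -> H (lie h a)) -> is_lie_subalgebra (line_hull H a).
Proof.
move=> [Hs Hl] Ha; split=> [|x y [i Hx] [j Hy]]; first exact: line_hull_subsp.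
apply: sub_line_hull.
rewrite -(subrK (i *: a) x) -(subrK (j *: a) y).
move: (x - _) (y - _) Hx Hy => u v Hu Hv.
rewrite lieDl !linearD /= lieZl !lieZr lieZl liexx !scaler0 addr0.
apply: (subspD Hs); last first.
  by rewrite [lie a v]lieC scalerN; apply: subspN => //; apply: subspZ => //; exact: Ha.
by apply: (subspD Hs); [exact: Hl|apply: subspZ => //; exact: Ha].
Qed.

(* Words in H and a can be rewritten with the letters a moved to the left. *)
Lemma line_hull_nilpotent H a : is_lie_subalgebra H -> H `<=` M -> M a -> ~ H a ->
  (forall h, H h -> H (lie h a)) -> acts_nilpotently H ->
  acts_nilpotently (line_hull H a).
Proof.
move=> Ha HM Mma nHa aH [p Hp]; have [q aq] := Mnil Mma.
pose HA := H `|` [set a].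
have HAM w : {in w, forall x, HA x} -> {in w, forall x, M x}.
  by move=> wH x /wH[/HM|->].
pose hc w := count (fun x => `[< H x >]) w.
have hcE w : {in w, forall x, H x} -> hc w = size w.
  by move=> wH; apply/eqP; rewrite -all_count; apply/allP => x /wH Hx; exact/asboolP.
have hca : `[< H a >] = false by apply/asboolP.
(* Once [a] is at the front, the word behind it is shorter with the same number of letters in H.
   Each commutator [x,a] lies in H, so its word is shorter too and keeps that number. *)
have D n w z : (size w <= n)%N -> {in w, forall x, HA x} -> (p <= hc w)%N ->
    M (word w z).
  elim: n w => [|n IH] w.
    by rewrite leqn0 => /nilP -> _ p0; apply: (Hp [::]).
  suff /(_ [::]) : forall v, {in v, forall x, H x} -> (size (v ++ w) <= n.+1)%N ->
    {in w, forall x, HA x} -> (p <= hc (v ++ w))%N -> M (word (v ++ w) z) by exact.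
  elim: w => [|x w IHw] v vH.
    rewrite cats0 => _ _ vp; apply: Hp => //; by rewrite -(hcE v vH).
  move=> sz wHA pw; have wHA' : {in w, forall x, HA x}.
    by move=> y yw; apply: wHA; rewrite inE yw orbT.
  have [Hx|xa] := wHA x (mem_head _ _).
    rewrite -cat_rcons; apply: IHw => //; rewrite ?cat_rcons//.
    by move=> y; rewrite mem_rcons inE => /predU1P[->|/vH].
  rewrite {x}xa in sz wHA pw *.
  have mix u : {in u, forall x, H x} -> {in u ++ w, forall x, HA x}.
    by move=> uH y; rewrite mem_cat => /orP[/uH|/wHA'//]; left.
  have pvw : (p <= hc (v ++ w))%N.
    by move: pw; rewrite /hc !count_cat /= hca add0n.
  have svw : (size (v ++ w) <= n)%N.
    by move: sz; rewrite !size_cat /= addnS ltnS.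
  suff : M (lie a (word (v ++ w) z) + (word (v ++ a :: w) z - lie a (word (v ++ w) z))).
    by rewrite addrC subrK.
  apply: (subspD Ma.1).
    by apply: Ma.2 => //; apply: IH => //; exact: mix.
  rewrite !word_cat /=; move: svw pvw; rewrite size_cat /hc count_cat.
  suff : forall v1 v2, {in v1, forall x, H x} -> {in v2, forall x, H x} ->
     (size v1 + size v2 + size w <= n)%N -> (p <= hc v1 + hc v2 + hc w)%N ->
     M (word v1 (lie a (word v2 (word w z))) - lie a (word v1 (word v2 (word w z)))).
    move=> /(_ v [::] vH); rewrite /= addn0 /hc /= addn0; exact.
  elim/last_ind => [|v1 x IHv] v2 v1H v2H s1 p1 /=.
    by rewrite subrr; exact: subsp0 Ma.1.
  have v1H' : {in v1, forall x, H x}.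
    by move=> y yv; apply: v1H; rewrite mem_rcons inE yv orbT.
  have Hx : H x by apply: v1H; rewrite mem_rcons inE eqxx.
  have xv2 : {in x :: v2, forall x, H x}.
    by move=> t; rewrite inE => /predU1P[->|/v2H].
  have := IHv (x :: v2) v1H' xv2.
  rewrite -!cats1 !word_cat /=.
  set X := word v2 (word w z) => IHx.
  have E : lie x (lie a X) = lie (lie x a) X + lie a (lie x X) by exact: lieA.
  rewrite E linearD /= -addrA; apply: (subspD Ma.1).
    have -> : word v1 (lie (lie x a) X) = word (v1 ++ (lie x a :: v2) ++ w) z.
      by rewrite !word_cat.
    have Hxa : H (lie x a) by exact: aH.
    apply: IH.
    - by move: s1; rewrite !size_cat size_rcons /= !addnA addnS.
    - rewrite catA; apply: mix => y; rewrite mem_cat inE.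
      by case/or3P => [/v1H'|/eqP->|/v2H].
    - move: p1; rewrite /hc -cats1 !count_cat /= addn0 !addnA.
      by rewrite (asboolT Hx) (asboolT Hxa).
  apply: IHx; first by move: s1; rewrite size_rcons /= !addSn addnS.
  by move: p1; rewrite /hc -cats1 !count_cat /= addn0 !addnA.
(* A block of q + 1 letters either contains a letter of H or is a power of ad a that sends
   everything into M, where the remaining letters keep it. *)
have E j w z : {in w, forall x, HA x} -> (j * q.+1 <= size w)%N ->
    (j <= hc w)%N \/ M (word w z).
  elim: j w => [|j IH] w wHA; first by left.
  rewrite mulSn => sz; pose w1 := take q.+1 w; pose w2 := drop q.+1 w.
  have w12 : w = w1 ++ w2 by rewrite cat_take_drop.
  have w1HA : {in w1, forall x, HA x} by move=> y /mem_take/wHA.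
  have w2HA : {in w2, forall x, HA x} by move=> y /mem_drop/wHA.
  have sz1 : size w1 = q.+1.
    by rewrite size_takel//; apply: leq_trans sz; exact: leq_addr.
  have [|hw2|Mw2] := IH w2 w2HA; first by rewrite size_drop leq_subRL// (leq_trans _ sz)// leq_addr.
    have [hw1|hw1] := posnP (hc w1); last first.
      by left; rewrite w12 /hc count_cat -add1n leq_add.
    right; have w1E : w1 = nseq q.+1 a.
      rewrite -sz1; apply/all_pred1P/allP => y yw1 /=.
      case: (w1HA y yw1) => [Hy|->//].
      have : has (fun x => `[< H x >]) w1 by apply/hasP; exists y => //; exact/asboolP.
      by rewrite has_count -/(hc w1) hw1.
    rewrite w12 word_cat w1E.
    have -> u : word (nseq q.+1 a) u = lie a (iter q (lie a) u).
      by rewrite /=; congr lie; elim: (q) => //= i ->.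
    exact: Ma.2.
  by right; rewrite w12 word_cat; apply: (word_sub Ma) => //; exact: HAM.
exists (p * q.+1)%N => w z wH sz.
apply: (word_span Ma (S := HA) (p := size w)) => //.
  move=> {}w' wHA sw; have [|hw|//] := E p w' z wHA; first by rewrite sw.
  exact: D hw.
move=> x /wH[k Hx]; have ls := lspan_subsp HA.
apply: (subsp_subr ls (sub_lspan _)); first by left; exact: Hx.
by apply: (subspZ _ ls); apply: sub_lspan; right.
Qed.

(* Jacobson's proof of Engel's theorem: a subalgebra acting nilpotently on L / M
   that is proper in M is enlarged by an element normalizing it. *)
Lemma engel_nilpotent : acts_nilpotently M.
Proof.
have [n [f [fF _]]] := finite_codim_surj (filt_subsp Ma 1) (filt_finite_codim Ma 1 Mf).
(* The size of H is measured by the number of its elements independent modulo [filt M 1], which is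
   at most the codimension [n] of [filt M 1]; H is chosen with this number maximal. *)
pose good H := [/\ is_lie_subalgebra H, filt M 1 `<=` H, H `<=` M & acts_nilpotently H].
pose P r := `[< exists H, good H /\ exists s : seq L,
  [/\ size s = r, {in s, forall x, H x} & free (map f s)] >].
have good1 : good (filt M 1).
  split=> //; last 2 first.
  - by move=> z; exact: filt_sub.
  - exists 1%N; elim/last_ind => // w x _ z wF _.
    have xF : filt M 1 x by apply: wF; rewrite mem_rcons inE eqxx.
    rewrite -cats1 word_cat; apply: (word_sub Ma).
      by move=> y yw; apply: (@filt_sub _ _ _ 1); apply: wF; rewrite mem_rcons inE yw orbT.
    exact: filt_liel xF.
  split=> [|a b /(@filt_sub _ _ _ 1) Ha]; first exact: filt_subsp.
  exact: filt_lieM.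
have P0 : exists r, P r.
  exists 0%N; apply/asboolP; exists (filt M 1); split=> //; exists [::].
  by split=> //=; rewrite nil_free.
have Pn r : P r -> (r <= n)%N.
  move=> /asboolP[H [_ [s [<- _]]]]; rewrite /free size_map => /eqP <-.
  by have := dimvS (subvf <<map f s>>); rewrite dimvf /dim /= mul1n.
have [r /asboolP[H [gH [s [sr sH fs]]]] rmax] := ex_maxnP P0 Pn.
have [Ha FH HM Hnil] := gH.
have [MH|MH] := pselect (M `<=` H).
  by have [p Hp] := Hnil; exists p => w z wM; apply: Hp => x /wM /MH.
exfalso; have [a0 Ma0 nHa0] : exists2 a, M a & ~ H a.
  apply: contrapT => nex; apply: MH => a aM; apply: contrapT => nHa.
  by apply: nex; exists a.
have [p Hp] := Hnil.
have [a [aM nHa aH]] : exists a, [/\ M a, ~ H a & forall h, H h -> H (lie h a)].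
  apply: contrapT => nex.
  (* Without a normalizing element, letters of H can be prepended for ever while the value on [a0]
     stays outside H. *)
  have step j : exists w, [/\ {in w, forall x, H x}, size w = j & ~ H (word w a0)].
    elim: j => [|j [w [wH sw nHw]]]; first by exists [::].
    have Mw : M (word w a0) by apply: (word_sub Ma) => // x /wH/HM.
    have [h [Hh nHh]] : exists h, H h /\ ~ H (lie h (word w a0)).
      apply: contrapT => nh; apply: nex; exists (word w a0); split=> // h Hh.
      by apply: contrapT => nHh; apply: nh; exists h.
    exists (h :: w); split; rewrite /= ?sw// => x.
    by rewrite inE => /predU1P[->|/wH].
  have [w [wH sw []]] := step (p + p)%N; apply: FH.
  have wM : {in w, forall x, M x} by move=> x /wH /HM.
  split=> [|y]; first exact: (word_sub Ma).
  rewrite lieC; apply: (subspN Ma.1).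
  (* Expanding the bracket by Jacobi distributes the 2p letters between the outside of the bracket
     and its right argument, so one of these receives at least p. *)
  suff /(_ w [::] [::] a0 y) : forall w v1 v2 b u, {in w, forall x, H x} ->
      {in v1, forall x, H x} -> {in v2, forall x, H x} -> M b ->
      (p + p <= size v1 + size v2 + size w)%N ->
      M (word v1 (lie (word w b) (word v2 u))).
    by rewrite sw; exact.
  elim=> [|x v IH] v1 v2 b u vH v1H v2H Mb /=.
    rewrite addn0 => sz.
    have [p2|p2] := leqP p (size v2).
      by apply: (word_sub Ma) => [x /v1H/HM//|]; apply: Ma.2 => //; exact: Hp.
    apply: Hp => //; rewrite -(leq_add2r p).
    by apply: leq_trans sz _; rewrite leq_add2l ltnW.
  have Hx : H x by apply: vH; rewrite inE eqxx.
  have vH' : {in v, forall x, H x} by move=> t tv; apply: vH; rewrite inE tv orbT.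
  rewrite addnS => sz; set B := word v b; set U := word v2 u.
  have -> : lie (lie x B) U = lie x (lie B U) - lie B (lie x U).
    by rewrite [lie x (lie B U)]lieA addrK.
  rewrite linearB /=; apply: (subspB Ma.1).
    have := IH (rcons v1 x) v2 b u; rewrite -cats1 word_cat /=; apply=> //.
      by move=> t; rewrite mem_cat inE => /orP[/v1H|/eqP->].
    by rewrite size_cat addn1 addSn.
  apply: (IH v1 (x :: v2)) => //.
    by move=> t; rewrite inE => /predU1P[->|/v2H].
  by rewrite /= addnS addSn.
have : P r.+1; last by move/rmax; rewrite ltnn.
apply/asboolP; exists (line_hull H a); split.
  split; [exact: line_hull_subalgebra| | |exact: line_hull_nilpotent].
    by apply: subset_trans FH _; exact: sub_line_hull.
  move=> z [k /HM Mz]; apply: (subsp_subr Ma.1 Mz); exact: subspZ Ma.1 _.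
exists (a :: s); split; rewrite /= ?sr//.
  move=> x; rewrite inE => /predU1P[->|/sH]; last exact: sub_line_hull.
  exact: mem_line_hull Ha.1.
rewrite free_cons fs andbT; apply/negP => /span_coords[c /fF/FH Hc]; apply: nHa.
apply: (subsp_subr Ha.1 Hc); apply: (subsp_sum _ Ha.1) => i _.
by apply: (subspZ _ Ha.1); apply: sH; exact: mem_nth.
Qed.

(** A vector outside M is moved by letters of M as long as it can stay outside M; nilpotency bounds
    the length of such words, and the last value is [v]. *)
Lemma engel : M <> setT -> exists2 v, ~ M v & forall m, M m -> M (lie m v).
Proof.
move=> MT; have [v0 nMv0] : exists v, ~ M v.
  apply: contrapT => nex; apply: MT; apply/seteqP; split=> // z _.
  by apply: contrapT => nMz; apply: nex; exists z.
apply: contrapT => nex; have [p Mp] := engel_nilpotent.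
have step j : exists w, [/\ {in w, forall x, M x}, size w = j & ~ M (word w v0)].
  elim: j => [|j [w [wM sw nMw]]]; first by exists [::].
  have [h [Mh nMh]] : exists h, M h /\ ~ M (lie h (word w v0)).
    apply: contrapT => nh; apply: nex; exists (word w v0) => // h Mh.
    by apply: contrapT => nMh; apply: nh; exists h.
  exists (h :: w); split; rewrite /= ?sw// => x.
  by rewrite inE => /predU1P[->|/wM].
by have [w [wM sw []]] := step p; apply: Mp => //; rewrite sw.
Qed.

End Engel.

(** * Maximal subalgebras: largest ideal inside and Frattini subalgebra *)

Definition maximal_subalgebra (K : numFieldType) (L : lieAlgType K) : set (set L) :=
  maximal_in [set N | is_lie_subalgebra N /\ is_proper N].

Section MaximalSubalgebras.
Context (K : numClosedFieldType) (L : lieAlgType K) (M : set L).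
Hypothesis K_archi : forall x : K, 0 <= x -> exists n : nat, x < n%:R.
Hypothesis Mmax : maximal_subalgebra M.
Hypothesis Mf : finite_codim M.
Hypothesis Mbound : forall h, M h -> exists2 c : K, 0 <= c &
  forall k a z, c < `|a| -> filt M k (shift (lie h) a z) -> filt M k z.

Let Ma : is_lie_subalgebra M := Mmax.1.1.

Lemma maximal_subalgebraP B : is_lie_subalgebra B -> M `<=` B ->
  B = M \/ B = setT.
Proof.
move=> Ba MB; have [BT|BT] := pselect (B = setT); first by right.
by left; apply: Mmax.2.
Qed.

(** In the annihilating product of ad h on L/M the factors with a nonzero root are injective and can
    be cancelled, which leaves a power of ad h. *)
Lemma eigenvalue_free_nilpotent h : M h ->
  (forall a v, a != 0 -> M (shift (lie h) a v) -> M v) ->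
  exists q, forall z, M (iter q (lie h) z).
Proof.
move=> Mh inj.
have [s sM] := finite_codim_shifts (D := lie h) Ma.1 (fun z => Ma.2 h z Mh) Mf.
exists (size s) => z; have {sM} := sM z.
elim: s z => //= a s IH z /IH Mz.
have : M (shift (lie h) a (iter (size s) (lie h) z)).
  apply: (mem_eq Mz); elim: (size s) => //= j ->.
  by rewrite /shift /= linearB /= lieZr.
have [->|a0] := eqVneq a 0; first by rewrite /shift scale0r subr0.
by move=> /(inj _ _ a0); exact: Ma.2.
Qed.

(** A nonzero eigenvalue of some h in M on L/M gives the second case. Without one, Engel's theorem
    gives v outside M with [M,v] in M; then M plus the line of v is L by maximality, and M is an
    ideal. *)
Lemma maximal_subalgebra_dichotomy :
  is_lie_ideal M \/ exists N, forall k z, lspan (M `|` adnil M N k) z.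
Proof.
have [[h [a [v [Mh a0 nMv av]]]]|nw] := pselect (exists h a v,
    [/\ M h, a != 0, ~ M v & M (shift (lie h) a v)]).
  right; have [c c0 hc] := Mbound Mh.
  exact: (adnil_span Ma Mf Mh c0 hc maximal_subalgebraP K_archi a0 nMv av).
left; have [h Mh|v nMv Mv] := engel Ma Mf _ Mmax.1.2.
  apply: eigenvalue_free_nilpotent => // a v a0 av; apply: contrapT => nMv.
  by apply: nw; exists h, a, v.
split=> [|x y My]; first exact: Ma.1.
have [BM|BT] := maximal_subalgebraP (line_hull_subalgebra Ma Mv) (@sub_line_hull _ _ M v).
  by case: nMv; rewrite -BM; exact: mem_line_hull Ma.1.
have : line_hull M v x by rewrite BT.
move=> [k Mx]; rewrite -(subrK (k *: v) x) lieDl lieZl.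
apply: (subspD Ma.1); first exact: Ma.2.
by apply: (subspZ _ Ma.1); rewrite lieC; apply: (subspN Ma.1); exact: Mv.
Qed.

Lemma filt_stabilizes : exists k, forall z, filt M k z -> filt M k.+1 z.
Proof.
have [[_ Mi]|[N nilspan]] := maximal_subalgebra_dichotomy.
  by exists 0%N => z Mz; split=> // y; exact: Mi.
exact: filt_stable nilspan.
Qed.

(** The stable term of the filtration is the largest ideal inside M; being some [filt M k], it
    inherits closedness and finite codimension from M. *)
Lemma maximal_subalgebra_core : exists J, [/\ is_lie_ideal J, J `<=` M,
  forall I, is_lie_ideal I -> I `<=` M -> I `<=` J & exists k, J = filt M k].
Proof.
have [k st] := filt_stabilizes; exists (filt M k); split.
- exact: filt_stable_ideal.
- exact: filt_sub.
- by move=> I Ii IM; exact: ideal_filt.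
- by exists k.
Qed.

Definition frattini : set L := \bigcap_(B in @maximal_subalgebra K L) B.

Lemma maximal_subalgebra_preim (f g : {linear L -> L}) B :
  cancel f g -> cancel g f -> (forall a b, f (lie a b) = lie (f a) (f b)) ->
  maximal_subalgebra B -> maximal_subalgebra [set z | B (f z)].
Proof.
move=> fK gK fl [[Ba BT] Bmax].
have gl a b : g (lie a b) = lie (g a) (g b).
  by apply: (can_inj fK); rewrite gK fl !gK.
have pre (p : {linear L -> L}) N : (forall a b, p (lie a b) = lie (p a) (p b)) ->
    is_lie_subalgebra N -> is_lie_subalgebra [set z | N (p z)].
  move=> pl Na; split=> [|a b pa pb /=]; first exact: subsp_preim Na.1.
  by rewrite pl; exact: Na.2.
split.
  split; first exact: pre.
  move=> fT; apply: BT; apply/seteqP; split=> // z _.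
  have : [set z | B (f z)] (g z) by rewrite fT.
  by rewrite /= gK.
move=> N [Na NT] BN.
have gN : [set z | N (g z)] = B.
  apply: Bmax.
    split; first exact: pre.
    move=> gT; apply: NT; apply/seteqP; split=> // z _.
    have : [set z | N (g z)] (f z) by rewrite gT.
    by rewrite /= fK.
  by move=> z Bz; apply: BN; rewrite /= gK.
by apply/seteqP; split=> z /=; rewrite -gN /= fK.
Qed.

Lemma frattini_subsp : is_subspace frattini.
Proof.
split=> [B [[[Bs _] _] _]|c a b Fa Fb B Bmax]; first exact: subsp0.
have Bs := Bmax.1.1.1.
by apply: (subspD Bs) (Fb B Bmax); apply: (subspZ _ Bs); exact: Fa.
Qed.

(* exp(t ad x) permutes the maximal subalgebras; the derivative in t of
   exp(t ad x) z is a combination of its values. *)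
Lemma frattini_adnil N k x z : filt M k = [set 0] -> adnil M N k.+1 x ->
  frattini z -> frattini (lie x z).
Proof.
move=> F0 xn Fz.
have xk : adnil M N k x by apply: adnil_le xn.
have EK t u : texp x (N + N) t (texp x (N + N) (- t) u) = u.
  have := texp_opp Ma t u xk; rewrite F0 => /eqP; rewrite subr_eq0 => /eqP //.
have EK' t u : texp x (N + N) (- t) (texp x (N + N) t u) = u.
  by have := EK (- t) u; rewrite opprK.
have El t a b : texp x (N + N) t (lie a b) =
    lie (texp x (N + N) t a) (texp x (N + N) t b).
  have := texp_lie Ma t a b xn; rewrite F0 => /eqP.
  by rewrite subr_eq0 => /eqP ->.
case: (posnP N) => [N0|N0].
  have : lie x z = 0.
    have := xk (lie x z); rewrite F0.
    have -> : iter N (lie x) (lie x z) = lie x z by rewrite N0.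
    exact.
  by move=> ->; exact: subsp0 frattini_subsp.
apply: (mem_eq (polynomial_coefs (n := N + N)
    (v := fun i => i`!%:R^-1 *: iter i (lie x) z) frattini_subsp _ (i := 1%N) _)).
- move=> t B Bmax.
  have -> : \sum_(i < N + N) t ^+ i *: (i`!%:R^-1 *: iter i (lie x) z) =
      texp x (N + N) t z by apply: eq_bigr => i _; rewrite scalerA.
  apply: (Fz [set z | B (texp x (N + N) t z)]).
  exact: (maximal_subalgebra_preim (f := texp x (N + N) t)
    (g := texp x (N + N) (- t)) (EK' t) (EK t) (El t) Bmax).
- by rewrite (leq_add N0 N0).
- by rewrite invr1 scale1r.
Qed.

(** [frattini] lies in every [filt M j], by induction on j: L is spanned by M, which preserves
    [filt M j], and by ad-nilpotent elements, which preserve [frattini]. *)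
Lemma frattini_trivial : (forall J, is_lie_ideal J -> J `<=` M -> J = [set 0]) ->
  frattini `<=` [set 0].
Proof.
move=> core0; have FM : frattini `<=` M by move=> z; exact.
have [Mi|[N nilspan]] := maximal_subalgebra_dichotomy.
  by rewrite -(core0 M Mi).
have [k st] := filt_stabilizes.
have F0 : filt M k = [set 0].
  by apply: core0 => //; [exact: filt_stable_ideal|exact: filt_sub].
rewrite -F0; elim: (k) => // j IH z Fz; split=> [|y]; first exact: IH.
have js := filt_subsp Ma j.
have ls : is_subspace [set y | filt M j (lie y z)].
  split=> [|d u v /= hu hv]; first by rewrite /= lie0l; exact: subsp0.
  by rewrite lie_linearl; apply: (subspD js) => //; exact: (subspZ _ js).
apply: (nilspan k.+1 y _ ls) => {}y [My|yn] /=; first by apply: filt_lieM => //; exact: IH.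
by apply: IH; exact: frattini_adnil yn Fz.
Qed.

End MaximalSubalgebras.

(** * Limits of complex sequences and growth of powers *)

Section ComplexLimits.
Context (R : realType).
Local Open Scope complex_scope.
Local Notation C := R[i].

Lemma complex_archi (x : C) : 0 <= x -> exists n : nat, x < n%:R.
Proof.
move=> x0; exists (Num.bound (complex.Re x)).
rewrite -[x]ReK// -(rmorph_nat (real_complex R)) ltcR.
by apply: archi_boundP; rewrite -lecR ReK.
Qed.

Lemma normc_real (r : R) : `|r%:C| = `|r|%:C :> C.
Proof. by rewrite normc_def /= expr0n addr0 sqrtr_sqr. Qed.

Lemma normc_ge_Im (x : C) : `|complex.Im x|%:C <= `|x|.
Proof.
rewrite -[complex.Im x]opprK -ReiNIm normrN.
by rewrite (le_trans (normc_ge_Re _))// normrM normCi mulr1.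
Qed.

Lemma normc_le_ReIm (x : C) :
  `|x| <= `|complex.Re x|%:C + `|complex.Im x|%:C.
Proof.
by rewrite {1}[x]complexE (le_trans (ler_normD _ _))// normrM normCi mul1r !normc_real.
Qed.

Lemma real_cauchy_seq (v : nat -> R) :
  (forall e, 0 < e -> exists N, forall n, (N <= n)%N -> `|v n - v N| < e) ->
  exists l, forall e, 0 < e -> exists N, forall n, (N <= n)%N -> `|l - v n| < e.
Proof.
move=> vc; have : cvg (v @ \oo).
  apply: (@cauchy_cvg R^o); apply: cauchy_exP => e e0.
  have [N vN] := vc e e0; exists (v N); exists N => // n /= Nn.
  by rewrite -ball_normE /= distrC; exact: vN.
move=> /cvgrPdist_lt vl; exists (lim (v @ \oo)) => e e0.
by have [N _ vN] := vl e e0; exists N => n Nn; exact: vN.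
Qed.

Lemma complex_cauchy_seq (u : nat -> C) :
  (forall e, 0 < e -> exists N, forall n, (N <= n)%N -> `|u n - u N| < e) ->
  exists l, forall e, 0 < e -> exists N, forall n, (N <= n)%N -> `|l - u n| < e.
Proof.
move=> uc.
have part (f : C -> R) : (forall x y, f (x - y) = f x - f y) ->
    (forall x, `|f x|%:C <= `|x|) -> exists l, forall e, 0 < e ->
    exists N, forall n, (N <= n)%N -> `|l - f (u n)| < e.
  move=> fB fn; apply: real_cauchy_seq => e e0.
  have [|N uN] := uc e%:C; first by rewrite ltcR.
  exists N => n Nn; rewrite -ltcR; apply: le_lt_trans (uN n Nn).
  by rewrite -fB.
have [||a aP] := part (@complex.Re R).
- by case=> [? ?] [? ?].
- exact: normc_ge_Re.
have [||b bP] := part (@complex.Im R).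
- by case=> [? ?] [? ?].
- exact: normc_ge_Im.
exists (a +i* b) => e e0.
have eE : (complex.Re e)%:C = e by rewrite ReK// ltW.
have e2 : 0 < complex.Re e / 2 by rewrite divr_gt0// -ltcR eE.
have [N1 h1] := aP _ e2; have [N2 h2] := bP _ e2.
exists (maxn N1 N2) => n; rewrite geq_max => /andP[n1 n2].
apply: le_lt_trans (normc_le_ReIm _) _.
rewrite -rmorphD -eE ltcR /= [ltRHS]splitr.
have := h1 n n1; have := h2 n n2; case: (u n) => x y /= hy hx.
exact: ltrD.
Qed.

End ComplexLimits.

(** Bernoulli's inequality for d / c; the case c = 0 is apart because of the quotient. *)
Lemma geometric_small (K : numFieldType) (c d B e : K) :
  (forall x : K, 0 <= x -> exists n : nat, x < n%:R) ->
  0 <= c -> c < d -> 0 <= B -> 0 < e -> exists n, c ^+ n * B < d ^+ n * e.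
Proof.
move=> archi c0 cd B0 e0; have d0 : 0 < d := le_lt_trans c0 cd.
have [->|cn0] := eqVneq c 0.
  by exists 1%N; rewrite !expr1 mul0r mulr_gt0.
have c1 : 0 < c by rewrite lt_def cn0.
have bern n : 1 + n%:R * (d / c - 1) <= (d / c) ^+ n.
  have q0 : 0 <= d / c - 1 by rewrite subr_ge0 ler_pdivlMr// mul1r ltW.
  elim: n => [|n IH]; first by rewrite mul0r addr0 expr0.
  have -> : 1 + n.+1%:R * (d / c - 1) = d / c - 1 + (1 + n%:R * (d / c - 1)).
    by rewrite -[n.+1%:R]natr1; ring.
  have -> : (d / c) ^+ n.+1 = (d / c - 1) * (d / c) ^+ n + (d / c) ^+ n.
    by rewrite exprS; ring.
  apply: lerD => //; rewrite -[leLHS]mulr1; apply: ler_wpM2l => //.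
  by apply: le_trans IH; rewrite lerDl mulr_ge0.
have q0 : 0 < d / c - 1 by rewrite subr_gt0 ltr_pdivlMr// mul1r.
have [n Bn] := archi (B / (e * (d / c - 1))) (divr_ge0 B0 (ltW (mulr_gt0 e0 q0))).
exists n; rewrite -ltr_pdivlMl ?exprn_gt0// mulrA [_^-1 * _]mulrC -expr_div_n.
apply: lt_le_trans (_ : (n%:R * (d / c - 1)) * e <= _).
  by rewrite -mulrA [_ * e]mulrC -ltr_pdivrMr// mulr_gt0.
by apply: ler_wpM2r; [exact: ltW|apply: le_trans (bern n); rewrite lerDr].
Qed.

(** * Closed subspaces of finite codimension in a Banach Lie algebra *)

Section ClosedSubspaces.
Context (R : realType) (L : banachLieType R[i]).
Local Notation C := R[i].
Implicit Types (A H J : set L) (z : L).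

Lemma closed_normP A : closed A <-> (forall z,
  (forall e : C, 0 < e -> exists2 m, A m & `|z - m| < e) -> A z).
Proof.
split=> [cA z zA|Ap z zA].
  apply: cA => B /nbhs_ballP[e /= e0 eB].
  have [m Am zm] := zA e e0; exists m; split=> //; apply: eB.
  by rewrite -ball_normE.
apply: Ap => e e0; have [m [Am]] := zA (ball z e) (nbhsx_ballx z e e0).
by rewrite -ball_normE => zm; exists m.
Qed.

Lemma closed_far A z : closed A -> ~ A z ->
  exists2 d : C, 0 < d & forall m, A m -> d <= `|z - m|.
Proof.
move=> /closed_normP cA nAz; apply: contrapT => nd; apply: nAz.
apply: cA => e e0; apply: contrapT => ne; apply: nd; exists e => // m Am.
rewrite real_leNgt ?ger0_real ?(ltW e0)//; apply/negP => zm.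
by apply: ne; exists m.
Qed.

(** [d] is a positive lower bound for the distance from [a] to [H]: the coefficient of [a] depends
    continuously on the vector. *)
Lemma coef_bound H a : is_subspace H -> closed H -> ~ H a ->
  exists2 d : C, 0 < d & forall k m, H m -> `|k| * d <= `|k *: a + m|.
Proof.
move=> Hs cH nHa; have [d d0 dP] := closed_far cH nHa; exists d => // k m Hm.
have [->|k0] := eqVneq k 0; first by rewrite normr0 mul0r.
have -> : k *: a + m = k *: (a - (- k^-1 *: m)).
  by rewrite scalerBr scalerA mulrN mulfV// scaleN1r opprK.
by rewrite normrZ ler_wpM2l//; apply: dP; exact: subspZ.
Qed.

(** By [coef_bound] the coefficients of approximations to z form a Cauchy sequence; with its limit
    l, z - l a is approximated by elements of the closed subspace [H]. *)
Lemma closed_line_hull H a : is_subspace H -> closed H -> closed (line_hull H a).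
Proof.
move=> Hs cH; have [Ha|nHa] := pselect (H a).
  suff -> : line_hull H a = H by [].
  apply/seteqP; split=> [z [k Hz]|]; last exact: sub_line_hull.
  by apply: (subsp_subr Hs Hz); exact: subspZ.
have [d d0 dP] := coef_bound Hs cH nHa.
apply/closed_normP => z zP.
have inv_gt0 n : 0 < (n.+1%:R : C)^-1 by rewrite invr_gt0 ltr0n.
have /choice[k kP] : forall n, exists k : C, exists2 m, H m &
    `|z - (k *: a + m)| < n.+1%:R^-1.
  move=> n; have [x [k Hx] zx] := zP _ (inv_gt0 n).
  by exists k, (x - k *: a) => //; rewrite [_ *: _ + _]addrC subrK.
have small e : 0 < e -> exists N, forall n, (N <= n)%N -> (n.+1%:R : C)^-1 < e.
  move=> e0; have ei0 : 0 <= e^-1 by rewrite invr_ge0 ltW.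
  have [N NP] := complex_archi ei0; exists N => n Nn.
  rewrite invf_plt ?posrE ?ltr0n//; apply: lt_le_trans NP _.
  by rewrite ler_nat leqW.
have [|l lP] := @complex_cauchy_seq R k.
  move=> e e0; have [|N NP] := small (e * d / 2).
    by rewrite divr_gt0// mulr_gt0.
  exists N => n Nn; have [m Hm nm] := kP n; have [p Hp Np] := kP N.
  rewrite -(ltr_pM2r d0); apply: le_lt_trans (dP (k n - k N) _ (subspB Hs Hm Hp)) _.
  have -> : (k n - k N) *: a + (m - p) = (z - (k N *: a + p)) - (z - (k n *: a + m)).
    by rewrite scalerBl opprB [RHS]addrC [RHS]addrA subrK opprD addrACA.
  apply: le_lt_trans (ler_normB _ _) _; rewrite [e * d]splitr; apply: ltrD.
    exact: lt_trans Np (NP _ _).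
  exact: lt_trans nm (NP _ Nn).
exists l; move/closed_normP: cH; apply=> e e0.
have [|N1 h1] := small (e / 2); first by rewrite divr_gt0.
have [|N2 h2] := lP (e / 2 / (1 + `|a|)).
  by rewrite !divr_gt0// ltr_pwDl.
pose n := maxn N1 N2; have [m Hm nm] := kP n; exists m => //.
have -> : z - l *: a - m = (z - (k n *: a + m)) - (l - k n) *: a.
  rewrite scalerBl opprB [RHS]addrC [RHS]addrA -[k n *: a - _ + z]addrA.
  by rewrite [k n *: a + (_ + z)]addrC addrKA [- _ + z]addrC.
apply: le_lt_trans (ler_normB _ _) _; rewrite [e]splitr; apply: ltrD.
  by apply: lt_trans nm (h1 _ _); exact: leq_maxl.
have := h2 n (leq_maxr _ _); rewrite ltr_pdivlMr ?ltr_pwDl// => h.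
by rewrite normrZ; apply: le_lt_trans h; rewrite ler_wpM2l// lerDr.
Qed.

(** [N] arises from [J] by adding finitely many lines, one at a time. *)
Lemma closed_superspace J N : is_subspace J -> closed J -> finite_codim J ->
  is_subspace N -> J `<=` N -> closed N.
Proof.
move=> Js cJ Jf Ns JN; have [n [f [fJ _]]] := finite_codim_surj Js Jf.
have [s [_ sN _ sP]] := select_basis f N.
pose H t := foldr (fun a B => line_hull B a) J t.
have HP t : [/\ is_subspace (H t), closed (H t), J `<=` H t &
    forall x, x \in t -> H t x].
  elim: t => [|a t [Hs cH JH tH]]; first by split.
  split=> /=; [exact: line_hull_subsp|exact: closed_line_hull| |].
    by apply: subset_trans JH _; exact: sub_line_hull.
  move=> x; rewrite inE => /predU1P[->|/tH Hx]; first exact: mem_line_hull.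
  exact: sub_line_hull.
suff -> : N = H s by have [] := HP s.
have [Hs _ JH sH] := HP s; apply/seteqP; split=> z.
  move=> /sP[c /fJ/JH Hz]; apply: (subsp_subr Hs Hz).
  by apply: (subsp_sum _ Hs) => i _; apply: (subspZ _ Hs); apply: sH; exact: mem_nth.
elim: (s) sN z => [|a t IH] tN z; first exact: JN.
case=> k /IH Nz; apply: (subsp_subr Ns).
  by apply: Nz => x xt; apply: tN; rewrite inE xt orbT.
by apply: (subspZ _ Ns); apply: tN; rewrite inE eqxx.
Qed.

(** The kernel of the coordinate contains the closed kernel of [f], so it is closed, and a
    functional with closed kernel is bounded. *)
Lemma coordinate_bounded n (f : {linear L -> 'rV[C]_n}) i :
  closed [set z | f z = 0] -> exists2 c : C, 0 <= c &
  forall z, `|f z 0 i| <= c * `|z|.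
Proof.
move=> cf; pose N := [set z | f z 0 i = 0].
have Ns : is_subspace N.
  split=> [|k a b]; rewrite /N /=; first by rewrite linear0 mxE.
  by move=> fa fb; rewrite linearP !mxE fa fb mulr0 addr0.
have cN : closed N.
  apply: (closed_superspace (subsp_ker f) cf (ker_finite_codim f) Ns) => z /= fz.
  by rewrite /N /= fz mxE.
have [NT|NT] := pselect (forall z, N z).
  by exists 0 => // z; rewrite NT normr0 mul0r.
have [u fu] : exists u, f u 0 i != 0.
  apply: contrapT => nu; apply: NT => z; apply/eqP; apply: contrapT => /negP fz.
  by apply: nu; exists z.
have nNu : ~ N u by move=> /= fu0; rewrite fu0 eqxx in fu.
have [d d0 dP] := coef_bound Ns cN nNu.
exists (`|f u 0 i| / d); first by rewrite divr_ge0// ltW.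
move=> z; rewrite mulrAC ler_pdivlMr//.
have := dP (f z 0 i / f u 0 i) (z - (f z 0 i / f u 0 i) *: u).
rewrite [_ *: _ + _]addrC subrK normrM normfV => dz.
rewrite [leRHS]mulrC -ler_pdivrMr ?normr_gt0// mulrAC; apply: dz.
by rewrite /N /= linearB linearZ !mxE mulfVK// subrr.
Qed.

Lemma filt_closed (M : set L) k : closed M -> closed (filt M k).
Proof.
move=> cM; elim: k => //= k /closed_normP IH; apply/closed_normP => z zP; split.
  by apply: IH => e e0; have [m [km _] zm] := zP e e0; exists m.
move=> y; apply: IH => e e0; have [t t0 tL] := lie_bounded (s := L).
(* The added 1 keeps the denominator positive when y = 0. *)
have ty : 0 < t * `|y| + 1 by rewrite ltr_wpDl// mulr_ge0// ltW.
have [m [_ ym] zm] := zP _ (divr_gt0 e0 ty); exists (lie y m) => //.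
rewrite -linearB /=; apply: le_lt_trans (tL _ _) _.
move: zm; rewrite ltr_pdivlMr// mulrDr mulr1 mulrC => zm.
by apply: le_lt_trans zm; rewrite lerDl.
Qed.

(** With c = t|h| and [h,z] = a z modulo [filt M k], also (ad h)^n z = a^n z there, so z is within
    (c/|a|)^n |z| of this closed subspace. *)
Lemma filt_eigenvalue_bound (M : set L) h : is_lie_subalgebra M -> closed M ->
  M h -> exists2 c : C, 0 <= c & forall k a z, c < `|a| ->
  filt M k (shift (lie h) a z) -> filt M k z.
Proof.
move=> Ma cM Mh; have [t t0 tL] := lie_bounded (s := L).
have c0 : 0 <= t * `|h| by rewrite mulr_ge0// ltW.
exists (t * `|h|) => // k a z ca az; have ks := filt_subsp Ma k.
have a0 : a != 0 by rewrite -normr_gt0; exact: le_lt_trans ca.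
have pow n : filt M k (iter n (lie h) z - a ^+ n *: z) /\
    `|iter n (lie h) z| <= (t * `|h|) ^+ n * `|z|.
  elim: n => [|n [IHf IHn]].
    by rewrite !expr0 scale1r subrr mul1r; split=> //; exact: subsp0.
  split; last first.
    by apply: le_trans (tL _ _) _; rewrite exprS -[leRHS]mulrA ler_wpM2l.
  apply: (mem_eq (subspD ks (filt_lieM Ma Mh IHf) (subspZ (a ^+ n) ks az))).
  rewrite linearB /= lieZr /shift scalerBr scalerA exprSr /=.
  by rewrite addrA subrK.
move/closed_normP: (filt_closed (k := k) cM); apply=> e e0.
have [n nP] := geometric_small (@complex_archi R) c0 ca (normr_ge0 z) e0.
have [nf nn] := pow n; exists (z - a ^- n *: iter n (lie h) z).
  have an0 : a ^+ n != 0 by rewrite expf_neq0.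
  apply: (mem_eq (subspZ (- a ^- n) ks nf)).
  by rewrite scalerBr scalerA mulNr mulVf// scaleN1r opprK addrC scaleNr.
rewrite opprB addrC subrK normrZ normfV normrX -ltr_pdivlMl ?invr_gt0 ?exprn_gt0 ?normr_gt0//.
by rewrite invrK; exact: le_lt_trans nn nP.
Qed.

End ClosedSubspaces.

(** * Quotient Banach Lie algebras of finite dimension *)

Section Quotient.
Context (R : realType) (L : banachLieType R[i]).
Local Open Scope complex_scope.
Local Notation C := R[i].

(* Encodes the quotient of L by a closed ideal of finite codimension, the kernel
   of qmap; qbase witnesses the surjectivity of qmap. *)
Record lie_quotient := LieQuotient {
  qdim : nat;
  qmap : {linear L -> 'rV[C]_qdim};
  qbase : 'I_qdim -> L;
  qbaseP : forall i, qmap (qbase i) = delta_mx 0 i;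
  qker_closed : closed [set z | qmap z = 0];
  qker_ideal : is_lie_ideal [set z | qmap z = 0]
}.

Variable q : lie_quotient.

(* An alias of the row vectors, which would otherwise carry the sup norm. *)
Definition quo := 'rV[C]_(qdim q).

HB.instance Definition _ := GRing.Lmodule.copy quo 'rV[C]_(qdim q).

Definition qproj (x : L) : quo := qmap q x.

Lemma qproj_linear : linear qproj.
Proof. by move=> k x y; rewrite /qproj linearP. Qed.

HB.instance Definition _ := GRing.isLinear.Build C L quo _ qproj qproj_linear.

(** A linear section of [qproj], in general not a Lie homomorphism; it transports completeness and
    the bracket to the quotient. *)
Definition qlift (v : quo) : L := \sum_i (v : 'rV_(qdim q)) 0 i *: qbase i.

Lemma qlift_linear : linear qlift.
Proof.
move=> k v w; rewrite /qlift scaler_sumr -big_split; apply: eq_bigr => i _.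
by rewrite !mxE scalerDl scalerA.
Qed.

HB.instance Definition _ := GRing.isLinear.Build C quo L _ qlift qlift_linear.

Lemma qliftK : cancel qlift qproj.
Proof.
move=> v; rewrite /qproj /qlift linear_sum [RHS]row_sum_delta.
by apply: eq_bigr => i _; rewrite linearZ qbaseP.
Qed.

(** The norms of the representatives of [v]; their infimum is the quotient norm. *)
Definition qnorms (v : quo) : set R :=
  [set complex.Re `|x| | x in [set x | qproj x = v]].

Lemma qnorms_lbound v : has_lbound (qnorms v).
Proof. by exists 0 => _ [x _ <-]; rewrite -lecR ReK//; exact: normr_ge0. Qed.

Lemma qnorms_neq0 v : qnorms v !=set0.
Proof. by exists (complex.Re `|qlift v|), (qlift v) => //; exact: qliftK. Qed.

Definition qnorm (v : quo) : C := (inf (qnorms v))%:C.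

Lemma qnorm_le x : qnorm (qproj x) <= `|x|.
Proof.
by rewrite -[`|x|]ReK// lecR; apply: ge_inf; [exact: qnorms_lbound|exists x].
Qed.

Lemma qnorm_ge (A : C) v : (forall x, qproj x = v -> A <= `|x|) -> A <= qnorm v.
Proof.
(* [A] is real because it is comparable with the norm of a representative. *)
move=> Av; have AE : (complex.Re A)%:C = A.
  by apply: RRe_real; rewrite (ler_real (Av _ (qliftK v))) normr_real.
rewrite -AE lecR; apply: lb_le_inf; first exact: qnorms_neq0.
by move=> _ [x xv <-]; rewrite -lecR AE ReK//; exact: Av.
Qed.

Lemma qnorm_ge0 v : 0 <= qnorm v.
Proof. exact: qnorm_ge. Qed.

Lemma qnorm_approx v (e : C) : 0 < e -> exists2 x, qproj x = v & `|x| < qnorm v + e.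
Proof.
move=> e0; have ereal : (complex.Re e)%:C = e by rewrite ReK// ltW.
have [||_ [x xv <-] xlt] := @inf_adherent _ (qnorms v) (complex.Re e).
- by rewrite -ltcR ereal.
- by split; [exact: qnorms_neq0|exact: qnorms_lbound].
by exists x => //; rewrite -[`|x|]ReK// -ereal -rmorphD ltcR.
Qed.

Lemma qnormD v w : qnorm (v + w) <= qnorm v + qnorm w.
Proof.
apply/ler_addgt0Pl => e e0; have e2 : 0 < e / 2 by rewrite divr_gt0.
have [x <- xe] := qnorm_approx v e2; have [y <- ye] := qnorm_approx w e2.
rewrite -linearD; apply: le_trans (qnorm_le _) _.
apply: le_trans (ler_normD _ _) _.
by rewrite [e]splitr [leRHS]addrC [leRHS]addrACA; apply: lerD; exact: ltW.
Qed.

Lemma qnormZ_le (k : C) v : qnorm (k *: v) <= `|k| * qnorm v.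
Proof.
have [->|k0] := eqVneq k 0.
  rewrite scale0r normr0 mul0r -(linear0 qproj).
  by apply: le_trans (qnorm_le _) _; rewrite normr0.
have k0' : 0 < `|k| by rewrite normr_gt0.
rewrite -ler_pdivrMl//; apply: qnorm_ge => x xv.
by rewrite ler_pdivrMl// -normrZ -xv -linearZ; exact: qnorm_le.
Qed.

Lemma qnormZ (k : C) v : qnorm (k *: v) = `|k| * qnorm v.
Proof.
apply/eqP; rewrite eq_le qnormZ_le /=.
have [->|k0] := eqVneq k 0; first by rewrite normr0 mul0r qnorm_ge0.
have k0' : 0 < `|k| by rewrite normr_gt0.
by rewrite -ler_pdivlMl// -normfV -[in leLHS](scalerK k0 v) qnormZ_le.
Qed.

Lemma qnorm_eq0 v : qnorm v = 0 -> v = 0.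
Proof.
move=> v0; rewrite -(qliftK v).
have /closed_normP := @qker_closed q; apply => e e0.
have [x xv] := qnorm_approx v e0; rewrite v0 add0r => xe.
exists (qlift v - x); last by rewrite opprB [qlift v + _]addrC subrK.
by rewrite /= linearB; move: (qliftK v) xv; rewrite /qproj => -> ->; rewrite subrr.
Qed.

HB.instance Definition _ := Lmodule_isNormed.Build C quo qnormD qnormZ qnorm_eq0.

Lemma qproj_norm x : `|qproj x| <= `|x|.
Proof. exact: qnorm_le. Qed.

(** Each coordinate is bounded on L, hence, by the infimum over representatives, for the quotient
    norm. *)
Lemma qlift_bounded : exists2 c : C, 0 <= c & forall v, `|qlift v| <= c * `|v|.
Proof.
have /choice[c cP] : forall i, exists c : C, 0 < c /\
    forall z, `|qmap q z 0 i| <= c * `|z|.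
  move=> i; have [c c0 cP] := coordinate_bounded i (@qker_closed q).
  exists (c + 1); split=> [|z]; first by rewrite ltr_wpDl.
  by apply: le_trans (cP z) _; rewrite mulrDl lerDl mul1r.
exists (\sum_i c i * `|qbase i|).
  by apply: sumr_ge0 => i _; have [c0 _] := cP i; rewrite mulr_ge0// ltW.
move=> v; rewrite mulr_suml; apply: le_trans (ler_norm_sum _ _ _) _.
apply: ler_sum => i _; have [c0 ci] := cP i.
rewrite normrZ mulrAC; apply: ler_wpM2r => //.
rewrite -ler_pdivrMl//; apply: qnorm_ge => x xv.
by rewrite ler_pdivrMl// -xv; exact: ci.
Qed.

Lemma quo_complete (F : set_system quo) : ProperFilter F -> cauchy F -> cvg F.
Proof.
move=> FF /cauchyP Fc; have [c c0 cP] := qlift_bounded.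
have c1 : 0 < c + 1 by rewrite ltr_wpDl.
have : cvg (qlift @ F).
  apply: cauchy_cvg; apply/cauchy_exP => e e0.
  have [v Fv] := Fc _ (divr_gt0 e0 c1); exists (qlift v); rewrite /nbhs /=.
  apply: filterS Fv => w /=; rewrite -!ball_normE /= -linearB ltr_pdivlMr//.
  apply: le_lt_trans; apply: le_trans (cP _) _.
  by rewrite mulrC; apply: ler_wpM2l => //; rewrite lerDl.
move=> /cvg_ex[x /cvgrPdist_lt Fx]; apply/cvg_ex; exists (qproj x).
apply/cvgrPdist_lt => e e0; apply: filterS (Fx e e0) => v.
apply: le_lt_trans; rewrite -{1}(qliftK v) -linearB; exact: qproj_norm.
Qed.

HB.instance Definition _ := Uniform_isComplete.Build quo quo_complete.

(** The kernel is an ideal, so the class of a bracket does not depend on the representatives. *)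
Lemma qproj_lie x y : qproj (lie (qlift (qproj x)) y) = qproj (lie x y).
Proof.
apply/eqP; rewrite -subr_eq0 -linearB -lieBl; apply/eqP.
rewrite lieC linearN; apply/eqP; rewrite oppr_eq0; apply/eqP.
apply: (@qker_ideal q).2 => /=.
have E : qproj (qlift (qproj x) - x) = 0 by rewrite linearB /= qliftK subrr.
exact: E.
Qed.

Lemma qproj_lier x y : qproj (lie x (qlift (qproj y))) = qproj (lie x y).
Proof. by rewrite lieC linearN /= qproj_lie -linearN /= -lieC. Qed.

Definition qlie (v w : quo) : quo := qproj (lie (qlift v) (qlift w)).

Lemma qlie_linearl w : linear (qlie^~ w).
Proof. by move=> k a b; rewrite /qlie linearP lie_linearl linearP. Qed.
Lemma qlie_linearr v : linear (qlie v).
Proof. by move=> k a b; rewrite /qlie linearP lie_linearr linearP. Qed.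
Lemma qliexx v : qlie v v = 0.
Proof. by rewrite /qlie liexx linear0. Qed.
Lemma qlie_jacobi a b c :
  qlie a (qlie b c) + qlie b (qlie c a) + qlie c (qlie a b) = 0.
Proof. by rewrite /qlie !qproj_lier -!linearD lie_jacobi linear0. Qed.

HB.instance Definition _ := Lmodule_isLie.Build C quo
  qlie_linearl qlie_linearr qliexx qlie_jacobi.

Lemma qprojL x y : qproj (lie x y) = lie (qproj x) (qproj y).
Proof. by rewrite /lie /= /qlie qproj_lie qproj_lier. Qed.

(** Infima over representatives, one variable at a time, keep the constant [t]; all quotients of L
    thus share a multiplication constant, as their normed direct product requires. *)
Lemma qlie_bounded (t : C) : mult_constant L t ->
  forall v w : quo, `|lie v w| <= t * `|v| * `|w|.
Proof.
move=> [t0 tL] v w.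
have scale (A B : C) (u : quo) : 0 <= B ->
    (forall x, qproj x = u -> A <= B * `|x|) -> A <= B * `|u|.
  move=> B0 AB; have [BE|Bn0] := eqVneq B 0.
    by have := AB _ (qliftK u); rewrite BE !mul0r.
  have Bp : 0 < B by rewrite lt_def Bn0.
  by rewrite -ler_pdivrMl//; apply: qnorm_ge => x /AB; rewrite ler_pdivrMl.
apply: (scale) => [|y yw]; first by rewrite mulr_ge0// ltW.
rewrite mulrAC; apply: (scale) => [|x xv]; first by rewrite mulr_ge0// ltW.
rewrite mulrAC -xv -yw -qprojL.
by apply: le_trans (tL x y); exact: qproj_norm.
Qed.

Lemma quo_lie_bounded : exists2 t : C, 0 < t &
  forall v w : quo, `|lie v w| <= t * `|v| * `|w|.
Proof.
have [t t0 tL] := lie_bounded (s := L).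
by exists t => //; apply: qlie_bounded.
Qed.

HB.instance Definition _ := NormedLie_isBanachLie.Build C quo quo_lie_bounded.

Lemma quo_has_dim : has_dim quo (qdim q).
Proof. by exists id => //; exists id. Qed.

Lemma qmult_constant (t : C) : mult_constant L t -> mult_constant quo t.
Proof. by move=> tL; split; [exact: tL.1|exact: qlie_bounded]. Qed.

End Quotient.

Lemma lie_quotient_exists (R : realType) (L : banachLieType R[i]) (J : set L) :
  is_lie_ideal J -> closed J -> finite_codim J ->
  exists q : lie_quotient L, forall z, J z <-> qproj q z = 0.
Proof.
move=> Ji cJ Jf; have [n [f [fJ fs]]] := finite_codim_surj Ji.1 Jf.
have /choice[e eP] : forall i : 'I_n, exists x, f x = delta_mx 0 i by [].
have JE := adapted_eq fJ; rewrite JE in Ji cJ.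
by exists (LieQuotient eP cJ Ji).
Qed.

(** * Subalgebras and ideals under surjective homomorphisms *)

Section Homomorphisms.
Context (K : numFieldType) (L F : lieAlgType K) (f : {linear L -> F}).
Hypothesis fl : forall a b, f (lie a b) = lie (f a) (f b).
Hypothesis fs : forall v, exists x, f x = v.

Lemma linear_preim_subsp B : is_subspace B -> is_subspace [set z | B (f z)].
Proof.
move=> Bs; split=> [|k a b /= fa fb]; first by rewrite /= linear0; exact: subsp0.
by rewrite linearP; apply: (subspD Bs) => //; exact: (subspZ _ Bs).
Qed.

Lemma linear_image_subsp B : is_subspace B -> is_subspace (f @` B).
Proof.
move=> Bs; split=> [|k _ _ [a Ba <-] [b Bb <-]].
  by exists 0; [exact: subsp0|rewrite linear0].
by exists (k *: a + b); [apply: (subspD Bs) => //; exact: (subspZ _ Bs)|rewrite linearP].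
Qed.

Lemma preim_subalgebra B : is_lie_subalgebra B -> is_lie_subalgebra [set z | B (f z)].
Proof.
move=> Ba; split=> [|a b /= fa fb]; first exact: linear_preim_subsp Ba.1.
by rewrite fl; exact: Ba.2.
Qed.

Lemma image_subalgebra B : is_lie_subalgebra B -> is_lie_subalgebra (f @` B).
Proof.
move=> Ba; split=> [|_ _ [a Ha <-] [b Hb <-]]; first exact: linear_image_subsp Ba.1.
by exists (lie a b); [exact: Ba.2|exact: fl].
Qed.

Lemma preim_ideal B : is_lie_ideal B -> is_lie_ideal [set z | B (f z)].
Proof.
move=> Bi; split=> [|a b /= fb]; first exact: linear_preim_subsp Bi.1.
by rewrite fl; exact: Bi.2.
Qed.

Lemma image_ideal B : is_lie_ideal B -> is_lie_ideal (f @` B).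
Proof.
move=> Bi; split=> [|w _ [b Hb <-]]; first exact: linear_image_subsp Bi.1.
have [a <-] := fs w; by exists (lie a b); [exact: Bi.2|exact: fl].
Qed.

Lemma ker_ideal : is_lie_ideal [set z | f z = 0].
Proof.
split=> [|a b /= fb]; first exact: subsp_ker.
by rewrite fl fb linear0.
Qed.

Lemma ker_finite_dim : finite_dim F -> finite_codim [set z | f z = 0].
Proof.
case=> n [g gl gb].
pose gm := GRing.isLinear.Build K F 'rV[K]_n _ g gl.
pose gL : {linear F -> 'rV[K]_n} := HB.pack g gm.
apply: finite_codimS (ker_finite_codim (gL \o f)) => z /= gfz.
by apply: (bij_inj gb); rewrite gfz -[g]/(gL : F -> _) linear0.
Qed.

Lemma image_mem B x : is_subspace B -> [set z | f z = 0] `<=` B ->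
  (f @` B) (f x) -> B x.
Proof.
move=> Bs kB [b Bb bx]; apply: (subsp_subr Bs _ Bb); apply: kB.
by rewrite /= linearB bx subrr.
Qed.

Lemma proper_preim B : is_proper B -> is_proper [set z | B (f z)].
Proof.
move=> BT fT; apply: BT; apply/seteqP; split=> // v _; have [x <-] := fs v.
by have : [set z | B (f z)] x by rewrite fT.
Qed.

Lemma proper_image B : is_subspace B -> [set z | f z = 0] `<=` B ->
  is_proper B -> is_proper (f @` B).
Proof.
move=> Bs kB BT fT; apply: BT; apply/seteqP; split=> // x _.
by apply: image_mem => //; rewrite fT.
Qed.

Lemma maximal_image M : maximal_subalgebra M -> [set z | f z = 0] `<=` M ->
  maximal_subalgebra (f @` M).
Proof.
move=> [[Ma MT] Mmax] kM; split.
  by split; [exact: image_subalgebra|apply: proper_image Ma.1 _ _].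
move=> N [Na NT] MN.
have NM : [set z | N (f z)] = M.
  apply: Mmax; first by split; [exact: preim_subalgebra|exact: proper_preim].
  by move=> z Mz; apply: MN; exists z.
apply/seteqP; split=> v; last exact: MN.
by have [x <-] := fs v => Nx; exists x => //; rewrite -NM.
Qed.

Lemma core_image M : is_subspace M -> [set z | f z = 0] `<=` M ->
  (forall I, is_lie_ideal I -> I `<=` M -> I `<=` [set z | f z = 0]) ->
  forall I, is_lie_ideal I -> I `<=` f @` M -> I = [set 0].
Proof.
move=> Ms kM core I Ii IM; apply/seteqP; split=> v; last first.
  by move=> ->; exact: subsp0 Ii.1.
have [x <-] := fs v => Ix; apply: (core [set z | I (f z)]) => //.
  exact: preim_ideal.
by move=> z /= /IM; exact: image_mem.
Qed.

End Homomorphisms.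

(** * One-dimensional Lie algebras *)

Lemma line_has_dim1 (K : numFieldType) (L : lieAlgType K) (a : L) : a <> 0 ->
  (forall v, exists k : K, v = k *: a) -> has_dim L 1.
Proof.
move=> /eqP a0 /choice[k kP].
have kZ (m : K) : k (m *: a) = m.
  apply/eqP; rewrite -subr_eq0.
  have : (k (m *: a) - m) *: a = 0 by rewrite scalerBl -kP subrr.
  by move/eqP; rewrite scaler_eq0 (negbTE a0) orbF.
exists (fun v => const_mx (k v)).
  move=> m v w; apply/rowP => i; rewrite !mxE.
  by rewrite {1}[v]kP {1}[w]kP scalerA -scalerDl kZ.
exists (fun r : 'rV[K]_1 => r 0 0 *: a) => [v|r]; first by rewrite mxE -kP.
by apply/rowP => i; rewrite mxE kZ ord1.
Qed.

Section DimensionOne.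
Context (K : numFieldType) (L : lieAlgType K).
Hypothesis L1 : has_dim L 1.

Lemma dim1_nonzero : exists a : L, a <> 0.
Proof.
have [g gl gb] := L1; have [h hK gK] := gb; exists (h (const_mx 1)) => h0.
pose gm := GRing.isLinear.Build K L 'rV[K]_1 _ g gl.
pose gL : {linear L -> 'rV[K]_1} := HB.pack g gm.
have := gK (const_mx 1); rewrite h0 -[g]/(gL : L -> _) linear0.
by move=> /rowP/(_ 0)/eqP; rewrite !mxE eq_sym oner_eq0.
Qed.

Lemma dim1_subspace (J : set L) : is_subspace J -> J = [set 0] \/ J = setT.
Proof.
move=> Js; have [J0|J0] := pselect (J `<=` [set 0]).
  by left; apply/seteqP; split=> // z ->; exact: subsp0.
have [a Ja a0] : exists2 a, J a & a <> 0.
  by apply: contrapT => na; apply: J0 => z Jz; apply: contrapT => z0; apply: na; exists z.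
have [g gl gb] := L1; pose gm := GRing.isLinear.Build K L 'rV[K]_1 _ g gl.
pose gL : {linear L -> 'rV[K]_1} := HB.pack g gm.
have ga : gL a 0 0 != 0.
  apply/eqP => ga; apply: a0; apply: (bij_inj gb); rewrite -[g]/(gL : L -> _) linear0.
  by apply/rowP => i; rewrite ord1 ga mxE.
right; apply/seteqP; split=> // z _.
suff -> : z = (gL z 0 0 / gL a 0 0) *: a by exact: subspZ.
apply: (bij_inj gb); rewrite -[g]/(gL : L -> _) linearZ.
by apply/rowP => i; rewrite ord1 !mxE mulfVK.
Qed.

Lemma dim1_set0_maximal : maximal_subalgebra [set 0 : L].
Proof.
have [a a0] := dim1_nonzero; split.
  split; last by move=> T0; apply: a0; have : [set 0] a by rewrite T0.
  split=> [|x y -> ->]; last by rewrite /= liexx.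
  by split=> [//|k x y -> ->]; rewrite /= scaler0 addr0.
by move=> N [[Ns _] NT] _; case: (dim1_subspace Ns).
Qed.

End DimensionOne.

(** * Passage between families of quotients and subdirect products *)

Section BanachFactors.
Context (R : realType) (L : banachLieType R[i]).
Local Notation C := R[i].

(** Every subalgebra above a closed one of finite codimension is closed, so maximality among closed
    subalgebras is maximality among all. *)
Lemma Smax_maximal_subalgebra (M : set L) : Smax L M -> maximal_subalgebra M.
Proof.
move=> [[[Ma cM MT] Mmax] Mf]; split=> // N [Na NT] MN; apply: Mmax => //.
by split=> //; exact: (closed_superspace Ma.1 cM Mf Na.1 MN).
Qed.

Lemma closed_set0 : closed [set 0 : L].
Proof.
apply/closed_normP => z z0; apply/eqP; rewrite -normr_eq0 eq_le normr_ge0 andbT.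
apply/ler_addgt0Pl => e e0; have [_ -> ze] := z0 e e0.
by rewrite addr0; move: ze; rewrite subr0 => /ltW.
Qed.

Lemma finite_dim_set0 : finite_dim L -> finite_codim [set 0 : L].
Proof.
move=> Ld; have := @ker_finite_dim _ L L idfun Ld.
by apply: finite_codimS => z.
Qed.

Lemma finite_dim_subspace_closed (M : set L) : finite_dim L ->
  is_subspace M -> closed M.
Proof.
move=> Ld Ms; have F0 := finite_dim_set0 Ld.
apply: (closed_superspace _ closed_set0 F0 Ms) => [|z ->]; last exact: subsp0.
by split=> [//|k x y -> ->]; rewrite /= scaler0 addr0.
Qed.

Lemma subsimple_frattini : subsimple L -> @frattini C L `<=` [set 0].
Proof.
move=> [Ld [L1|[M Mmax Mcore]]].
  by move=> z Fz; apply: (Fz [set 0]); exact: dim1_set0_maximal.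
have Ma : is_lie_subalgebra M := Mmax.1.1.
have cM := finite_dim_subspace_closed Ld Ma.1.
apply: (frattini_trivial (@complex_archi R) Mmax) => //.
  apply: finite_codimS (finite_dim_set0 Ld) => z ->; exact: subsp0 Ma.1.
by move=> h Mh; exact: filt_eigenvalue_bound.
Qed.

Lemma Smax_core (M : set L) : Smax L M -> exists q : lie_quotient L,
  [set z | qproj q z = 0] `<=` M /\ forall I, is_lie_ideal I -> I `<=` M ->
    I `<=` [set z | qproj q z = 0].
Proof.
move=> SM; have Mmax := Smax_maximal_subalgebra SM.
have Ma : is_lie_subalgebra M := Mmax.1.1.
have [[[_ cM _] _] Mf] := SM.
have [|J [Ji JM Jcore [k JE]]] :=
    maximal_subalgebra_core (@complex_archi R) Mmax Mf.
  by move=> h Mh; exact: filt_eigenvalue_bound.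
have cJ : closed J by rewrite JE; exact: filt_closed.
have Jf : finite_codim J by rewrite JE; exact: filt_finite_codim.
have [q qJ] := lie_quotient_exists Ji cJ Jf; exists q; split.
  by move=> z /qJ/JM.
by move=> I Ii IM z Iz; apply/qJ; exact: Jcore Iz.
Qed.

(** The diagonal map to the product of the quotients has bound 1 and is injective by the separation
    hypothesis. *)
Lemma subdirect_of_quotients (P : lieAlgType C -> Prop) (Q : set (lie_quotient L)) :
  (forall q, Q q -> P (quo q)) ->
  (forall z, (forall q, Q q -> qproj q z = 0) -> z = 0) ->
  is_subdirect_product_of L P.
Proof.
move=> QP Qsep; have [t t0 tL] := lie_bounded (s := L).
have tm : mult_constant L t by split.
pose sp (s : {q | Q q}) : banachLieType C := quo (sval s).
have spc s : mult_constant (sp s) t by exact: qmult_constant.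
have spb : exists T : C, forall s : {q | Q q}, t <= T by exists t.
pose E := BanachLieFamily spc spb.
exists E; split=> [[q Qq]|]; first exact: QP.
have bnd x : exists r : C, forall s : fam_index E, `|(qproj (sval s) x : E s)| <= r.
  by exists `|x| => s; exact: qproj_norm.
pose theta x : ndprod E := NDProd (bnd x).
have tlin : linear theta.
  by move=> k x y; apply: ndprodP => s /=; exact: linearP.
have tlie a b : theta (lie a b) = lie (theta a) (theta b).
  by apply: ndprodP => s /=; exact: qprojL.
exists (range theta), theta; split.
  split; last first.
    move=> s; apply/seteqP; split=> // v _.
    by exists (theta (qlift v)); [exists (qlift v)|exact: qliftK].
  split; last by move=> _ _ [a _ <-] [b _ <-]; exists (lie a b).
  split; first by exists 0 => //; apply: ndprodP => s /=; exact: linear0.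
  by move=> k _ _ [a _ <-] [b _ <-]; exists (k *: a + b) => //; rewrite tlin.
split=> //.
  by exists 1 => x; rewrite mul1r; apply: ndnorm_le => // s; exact: qproj_norm.
split; [by move=> x _; exists x| |by []].
move=> x y _ _ txy; apply/eqP; rewrite -subr_eq0; apply/eqP; apply: Qsep => q Qq.
rewrite linearB /=; apply/eqP; rewrite subr_eq0; apply/eqP.
exact: (congr1 (fun u : ndprod E => u (exist _ q Qq)) txy).
Qed.

(** The maps [f i] are the coordinates of the isomorphism, with closed kernels by boundedness and
    jointly injective. *)
Lemma subdirect_factors (P : lieAlgType C -> Prop) :
  is_subdirect_product_of L P ->
  exists (I : Type) (F : I -> banachLieType C) (f : forall i, {linear L -> F i}),
  [/\ forall i, P (F i), forall i a b, f i (lie a b) = lie (f i a) (f i b),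
      forall i v, exists x, f i x = v, forall i, closed [set z | f i z = 0] &
      forall z, (forall i, f i z = 0) -> z = 0].
Proof.
move=> [E [EP [M [theta [[_ Msurj] [tlin tlie [r tr] [tM tinj tsurj]]]]]]].
have lin (i : fam_index E) : linear (fun x => theta x i).
  by move=> k x y; rewrite tlin.
pose fm i := GRing.isLinear.Build C L (E i) _ (fun x => theta x i) (lin i).
pose f i : {linear L -> E i} := HB.pack (fun x => theta x i) (fm i).
exists (fam_index E), (fun i => E i), f; split.
- by [].
- by move=> i a b /=; rewrite tlie.
- move=> i v; have : [set: E i] v by [].
  by rewrite -(Msurj i) => -[a Ma <-]; have [x _ <-] := tsurj a Ma; exists x.
- move=> i; apply/closed_normP => z zk /=.
  (* [r] is an arbitrary complex constant; [|r| + 1] is a bound that is surely positive. *)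
  have fn x : `|f i x| <= (`|r| + 1) * `|x|.
    apply: le_trans (ndnorm_ub (theta x) i) _; have rx := tr x.
    have rx0 : 0 <= r * `|x| by apply: le_trans rx; exact: ndnorm_ge0.
    apply: le_trans rx _; rewrite -(ger0_norm rx0) normrM normr_id.
    by apply: ler_wpM2r => //; rewrite lerDl.
  apply/eqP; apply: contrapT => /negP fz.
  have [|m /= fm0 zm] := zk (`|f i z| / (`|r| + 1)).
    by rewrite divr_gt0 ?normr_gt0// ltr_wpDl.
  have fm0' : f i m = 0 by [].
  have := fn (z - m); rewrite linearB fm0' subr0 mulrC.
  move: zm; rewrite ltr_pdivlMr ?ltr_wpDl// => zm /le_lt_trans/(_ zm).
  by rewrite ltxx.
- move=> z fz; apply: tinj; rewrite ?inE//; apply: ndprodP => i.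
  by have := fz i; have := linear0 (f i) => /= -> ->.
Qed.

End BanachFactors.

(** * The three equivalences *)

Section Semisimplicity.
Context (R : realType) (L : banachLieType R[i]).
Local Notation C := R[i].

Lemma Sem_intro (G : set (set L)) : (forall M, G M -> is_subspace M) ->
  (forall z, (forall M, G M -> M z) -> z = 0) -> Sem G.
Proof.
move=> Gs G0; apply/seteqP; split=> z; first exact: G0.
by move=> -> M /Gs; exact: subsp0.
Qed.

Lemma Sem_elim (G : set (set L)) z : Sem G -> (forall M, G M -> M z) -> z = 0.
Proof.
by move=> G0 Gz; have : (\bigcap_(M in G) M) z by []; rewrite G0.
Qed.

(** Forward, the quotients by the largest ideals inside the members of [Smax] are subsimple.
    Backward, preimages of maximal subalgebras of the factors are in [Smax], and the factors have
    trivial [frattini]. *)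
Lemma Sem_Smax : Sem (Smax L) <-> is_subdirect_product_of L (fun M => subsimple M).
Proof.
split=> [S0|/subdirect_factors[I [F [f [FP fl fs cf finj]]]]].
  apply: (subdirect_of_quotients (Q := [set q | exists2 M, Smax L M &
      [set z | qproj q z = 0] `<=` M /\ forall I, is_lie_ideal I -> I `<=` M ->
      I `<=` [set z | qproj q z = 0]])).
    move=> q [M SM [qM qcore]]; split; first by exists (qdim q); exact: quo_has_dim.
    have Mmax := Smax_maximal_subalgebra SM.
    have qs v : exists x, qproj q x = v by exists (qlift v); exact: qliftK.
    right; exists ((qproj q : {linear L -> quo q}) @` M).
      exact: (maximal_image (f := qproj q) (@qprojL _ _ q)).
    apply: (core_image (f := qproj q) (@qprojL _ _ q)) => //.
    exact: Mmax.1.1.1.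
  move=> z qz; apply: (Sem_elim S0) => M SM; have [q qM] := Smax_core SM.
  by apply: qM.1; apply: qz; exists M.
apply: Sem_intro => [M [[[[]]]]//|z Sz]; apply: finj => i.
apply: (subsimple_frattini (FP i)) => B Bmax.
have Bs : is_subspace B := Bmax.1.1.1.
have kf := ker_finite_dim (f i) (FP i).1.
have kB : [set z | f i z = 0] `<=` [set z | B (f i z)].
  by move=> x /= ->; exact: subsp0.
have Ba := preim_subalgebra (fl i) Bmax.1.1.
apply: (Sz [set z | B (f i z)]); split; last exact: finite_codimS kB kf.
split.
  split=> //; last exact: (proper_preim (fs i) Bmax.1.2).
  exact: (closed_superspace (subsp_ker (f i)) (cf i) kf Ba.1 kB).
(* [N] contains the kernel of [f i], so its image is still proper and equals [B] by maximality. *)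
move=> N [Na cN NT] BN.
have kN := subset_trans kB BN.
have NE : f i @` N = B.
  apply: Bmax.2; first by split; [exact: (image_subalgebra (fl i) Na)|exact: (proper_image Na.1 kN NT)].
  by move=> v Bv; have [x xv] := fs i v; exists x => //; apply: BN; rewrite /= xv.
apply/seteqP; split=> // x Nx /=; rewrite -NE; by exists x.
Qed.

(** A quotient by a maximal closed ideal of finite codimension has only trivial ideals; conversely,
    the kernel of a map onto a nonzero factor with only trivial ideals is maximal. *)
Lemma Sem_Jmax : Sem (Jmax L) <-> is_subdirect_product_of L
  (fun M => (finite_dim M /\ lie_simple M) \/ has_dim M 1).
Proof.
split=> [S0|/subdirect_factors[I [F [f [FP fl fs cf finj]]]]].
  apply: (subdirect_of_quotients (Q := [set q | Jmax L [set z | qproj q z = 0]])).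
    move=> q [[[Ji cJ JT] Jmax_] Jf].
    have qs v : exists x, qproj q x = v by exists (qlift v); exact: qliftK.
    have triv I : is_lie_ideal I -> I = [set 0] \/ I = [set: quo q].
      move=> Ii; have [IT|IT] := pselect (I = setT); first by right.
      have Ni := preim_ideal (f := qproj q) (@qprojL _ _ q) Ii.
      have JN : [set z | qproj q z = 0] `<=` [set z | I (qproj q z)].
        by move=> x /= ->; exact: subsp0 Ii.1.
      have NE : [set z | I (qproj q z)] = [set z | qproj q z = 0].
        apply: Jmax_ => //; split=> //; last exact: (proper_preim (f := qproj q) qs).
        exact: (closed_superspace Ji.1 cJ Jf Ni.1 JN).
      left; apply/seteqP; split=> v; last by move=> ->; exact: subsp0 Ii.1.
      have [x <-] := qs v => Ix.
      by have : [set z | I (qproj q z)] x by []; rewrite NE.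
    (* With a nonzero bracket the quotient is simple; with zero bracket every line is an ideal, so
       the quotient is a line. *)
    have [nab|ab] := pselect (exists a b : quo q, lie a b <> 0).
      by left; split=> //; exists (qdim q); exact: quo_has_dim.
    right; have {}ab (a b : quo q) : lie a b = 0.
      by apply: contrapT => nab; apply: ab; exists a, b.
    have [a a0] : exists a : quo q, a <> 0.
      apply: contrapT => na; apply: JT; apply/seteqP; split=> // z _ /=.
      by apply: contrapT => nz; apply: na; exists (qproj q z).
    have lineT : [set v | exists k : C, v = k *: a] = [set: quo q].
      have [||//] := triv [set v | exists k : C, v = k *: a].
        split=> [|x y _]; last by exists 0; rewrite ab scale0r.
        split=> [|k _ _ [m ->] [n ->]]; first by exists 0; rewrite scale0r.
        by exists (k * m + n); rewrite scalerDl scalerA.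
      move=> E; have : [set v | exists k : C, v = k *: a] a.
        by exists 1; rewrite scale1r.
      by rewrite E.
    apply: (line_has_dim1 a0) => v; have : [set: quo q] v by [].
    by rewrite -lineT.
  move=> z qz; apply: (Sem_elim S0) => J SJ.
  have [[[Ji cJ _] _] Jf] := SJ; have [q qJ] := lie_quotient_exists Ji cJ Jf.
  apply/qJ; apply: qz => /=.
  by have <- : J = [set z | qproj q z = 0] by apply/seteqP; split=> x /qJ.
apply: Sem_intro => [M [[[[]]]]//|z Sz]; apply: finj => i.
have Fd : finite_dim (F i) by case: (FP i) => [[]//|F1]; exists 1%N.
have Ftriv J : is_lie_ideal J -> J = [set 0] \/ J = [set: F i].
  case: (FP i) => [[_ [_]]|F1 [Js _]]; first exact.
  exact: dim1_subspace.
have [a a0] : exists a : F i, a <> 0.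
  case: (FP i) => [[_ [[a [b ab]] _]]|F1]; first by exists (lie a b).
  exact: dim1_nonzero.
apply: (Sz [set z | f i z = 0]); split; last exact: ker_finite_dim.
have ki := ker_ideal (fl i); split.
  split=> [//||kT]; first exact: cf.
  have [x xa] := fs i a; apply: a0; rewrite -xa.
  by have : [set z | f i z = 0] x by rewrite kT.
move=> N [Ni cN NT] kN.
have [E|E] := Ftriv _ (image_ideal (fl i) (fs i) Ni).
  apply/seteqP; split=> // x Nx /=; have : (f i @` N) (f i x) by exists x.
  by rewrite E.
by have := proper_image Ni.1 kN NT; rewrite E.
Qed.

Lemma Sem_Jfin : Sem (Jfin L) <-> is_subdirect_product_of L (fun M => finite_dim M).
Proof.
split=> [S0|/subdirect_factors[I [F [f [FP fl fs cf finj]]]]].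
  apply: (subdirect_of_quotients (Q := setT)).
    by move=> q _; exists (qdim q); exact: quo_has_dim.
  move=> z qz; apply: (Sem_elim S0) => J [[Ji cJ _] Jf].
  have [q qJ] := lie_quotient_exists Ji cJ Jf.
  by apply/qJ; exact: qz.
apply: Sem_intro => [M [[[]]]//|z Sz]; apply: finj => i.
(* A zero factor has all of L as kernel, which is not a proper ideal; there the coordinate of z
   vanishes anyway. *)
have [kT|kT] := pselect ([set z | f i z = 0] = setT).
  by have : [set z | f i z = 0] z by rewrite kT.
apply: (Sz [set z | f i z = 0]); split; last exact: ker_finite_dim.
by split; [exact: (ker_ideal (fl i))|exact: cf|].
Qed.

End Semisimplicity.

Theorem theorem9p9 (R : realType) (L : banachLieType R[i]) :
  [/\ Sem (Smax L) <-> is_subdirect_product_of L (fun M => subsimple M),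
      Sem (Jmax L) <-> is_subdirect_product_of L
        (fun M => (finite_dim M /\ lie_simple M) \/ has_dim M 1) &
      Sem (Jfin L) <-> is_subdirect_product_of L (fun M => finite_dim M)].
Proof. split; [exact: Sem_Smax|exact: Sem_Jmax|exact: Sem_Jfin]. Qed.
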